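(* In the randomized $\mathsf{CD}$ model, for any $\epsilon\in(0,1)$, $\mathsf{Broadcast}$ on an $n$-vertex network of maximum degree $\Delta$ can be solved with high probability in $O\!\left(\frac{n\log\Delta\log^{2+\epsilon}n}{\epsilon\log\log n}\right)$ time with energy cost $O\!\left(\frac{\log^2 n}{\epsilon\log\log n}\right)$.
   Context: Radio network model: connected undirected graph with $n$ vertices and maximum degree $\Delta$ (known to vertices); synchronized slots; each vertex transmits, listens or idles per slot; transmit/listen cost one unit of energy; energy = maximum per-vertex number of transmit/listen slots. $\mathsf{CD}$: a listener receives the message if exactly one neighbor transmits, hears silence if none, and noise (distinguishable from silence) if at least two. Randomized algorithms use private random bits; ''with high probability'' = failure probability $\le1/\mathrm{poly}(n)$. $\mathsf{Broadcast}$: a source vertex holds a message that all vertices must learn. *)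

(* Defs.v *)
From Stdlib Require Import Reals.
From mathcomp Require Import all_boot.

Set Implicit Arguments.
Unset Strict Implicit.
Unset Printing Implicit Defensive.

Definition simple_graph (n : nat) (e : rel 'I_n) : Prop :=
  symmetric e /\ irreflexive e.

Definition connected_graph (n : nat) (e : rel 'I_n) : Prop :=
  forall u v : 'I_n, connect e u v.

Definition max_degree (n : nat) (e : rel 'I_n) : nat :=
  \max_(v : 'I_n) #|[set u | e v u]|.

(* Packets carry an arbitrary natural number (any finite content). *)
Inductive action := Idle | Listen | Transmit of nat.

Inductive feedback := FNone | FSilence | FNoise | FRecv of nat.

Definition sent (a : action) : option nat :=
  if a is Transmit p then Some p else None.

Definition active (a : action) : bool :=
  if a is Idle then false else true.

(* A (uniform, anonymous) randomized protocol: every vertex runs the same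
   code; its local input is [Some m] if it is the source holding message m,
   [None] otherwise; it owns a private string of [rbits] uniform random bits;
   in each slot its action depends only on its input, its random bits and the
   feedback it has perceived so far.  The protocol runs for [slots] slots,
   after which each vertex outputs its guess of the message.  [budget] is the
   energy budget claimed for the protocol. *)
Record protocol := Protocol {
  rbits  : nat;
  slots  : nat;
  budget : nat;
  act_fn : option nat -> seq bool -> seq feedback -> action;
  out_fn : option nat -> seq bool -> seq feedback -> option nat
}.

Section Execution.
Variables (P : protocol) (n : nat) (e : rel 'I_n)
          (inp : 'I_n -> option nat) (rnd : 'I_n -> seq bool).

Definition feedback_of (A : 'I_n -> action) (v : 'I_n) : feedback :=
  match A v with
  | Listen =>
      let S := [set u | e v u & isSome (sent (A u))] in
      if #|S| == 0 then FSilence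
      else if #|S| == 1 then
        match [pick u in S] with
        | Some u => if sent (A u) is Some p then FRecv p else FNoise
        | None => FNoise
        end
      else FNoise
  | _ => FNone
  end.

Fixpoint history (t : nat) : 'I_n -> seq feedback :=
  match t with
  | 0 => fun _ => [::]
  | t'.+1 =>
      let h := history t' in
      let A := fun v => act_fn P (inp v) (rnd v) (h v) in
      fun v => rcons (h v) (feedback_of A v)
  end.

Definition action_at (t : nat) (v : 'I_n) : action :=
  act_fn P (inp v) (rnd v) (history t v).

Definition energy (v : 'I_n) : nat :=
  \sum_(t < slots P) active (action_at t v).

Definition output (v : 'I_n) : option nat :=
  out_fn P (inp v) (rnd v) (history (slots P) v).

End Execution.

Definition run_ok (P : protocol) (n : nat) (e : rel 'I_n) (s : 'I_n) (m : nat)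
    (f : {ffun 'I_n -> (rbits P).-tuple bool}) : bool :=
  let inp := fun v : 'I_n => if v == s then Some m else None in
  let rnd := fun v : 'I_n => tval (f v) in
  [forall v, (@output P n e inp rnd v == Some m)
             && (@energy P n e inp rnd v <= budget P)].

(* With high probability: failure probability (over independent uniform
   random strings of all vertices) at most 1 / n^c. *)
Definition whp_success (c : nat) (P : protocol) (n : nat) (e : rel 'I_n)
    (s : 'I_n) (m : nat) : Prop :=
  #|[set f : {ffun 'I_n -> (rbits P).-tuple bool} | ~~ @run_ok P n e s m f]| * n ^ c
    <= #|{: {ffun 'I_n -> (rbits P).-tuple bool}}|.

Section Bounds.
Local Open Scope R_scope.

Definition time_bound (eps : R) (n D : nat) : R :=
  (INR n * ln (INR D) * Rpower (ln (INR n)) (2 + eps)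
     / (eps * ln (ln (INR n)))).

Definition energy_bound (eps : R) (n : nat) : R :=
  (ln (INR n) ^ 2 / (eps * ln (ln (INR n)))).

End Bounds.

(* Main.v *)
(** A labelling of the vertices is good when every vertex of label l+1 has a
    neighbour of label l; the vertices of label 0 are the roots.  Starting from
    the zero labelling, each phase keeps the source and a random fraction
    p = 2^-j of the roots and relabels outwards from them.  A sweep (down the
    layers of the old labelling, once across all edges, up the layers) carries
    new labels from a cluster to all adjacent clusters, so after s = 4^j sweeps
    only the roots without a sampled root among the next s roots towards the
    source stay unlabelled, which has probability at most (1-p)^s <= p; these
    keep label 0.  Hence a non-source root survives a phase with probability at
    most 2p, and O(log n / j) phases leave the source as the only root, at which
    point the message, carried along with the labels, is known everywhere.

    A relay from a set of senders to its neighbours costs energy O(log n).  In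
    each epoch a sender transmits at level i with probability 2^-i, and a
    receiver listens at a single level that moves up on noise and down on
    silence: this biased walk stays close to log2 of the number of sending
    neighbours, where every epoch succeeds with constant probability.  A
    receiver without sending neighbours finds out in one slot by collision
    detection.  Since a vertex sends in at most three relays per phase and
    receives in one, a phase costs O(log n + s).  With 2^j about
    (log n)^(eps/4) there are O(log n / (eps log log n)) phases. *)

Require Import Defs.
From Stdlib Require Import ZArith Reals Lra FunctionalExtensionality.
From mathcomp Require Import all_boot.

Set Implicit Arguments.
Unset Strict Implicit.
Unset Printing Implicit Defensive.

(** * Choice of the parameters and cost bounds *)

Section Tuned.
Local Open Scope R_scope.

Lemma INR_addn p q : INR (p + q)%N = INR p + INR q.
Proof. exact: plus_INR. Qed.

Lemma INR_muln p q : INR (p * q)%N = INR p * INR q.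
Proof. exact: mult_INR. Qed.

Lemma INR_expn b k : INR (b ^ k) = INR b ^ k.
Proof. by elim: k => [|k IH] //; rewrite expnS INR_muln IH. Qed.

Lemma INR_le_leq p q : (p <= q)%N -> INR p <= INR q.
Proof. by move/leP/le_INR. Qed.

Lemma ln2_bounds : 1 / 2 < ln 2 < 1.
Proof.
have H := ln_lt_2; split; first lra.
have : ln 2 < ln (exp 1).
  by apply: ln_increasing; [lra|have := exp_ineq1 1; lra].
by rewrite ln_exp.
Qed.

Lemma ln_le_sub1 x : 0 < x -> ln x <= x - 1.
Proof.
move=> x0; have : exp (ln x) = x by apply: exp_ln.
by have := exp_ineq1_le (ln x); lra.
Qed.

Lemma ln_le x y : 0 < x -> x <= y -> ln x <= ln y.
Proof. by move=> x0 [H|->]; [left; apply: ln_increasing|right]. Qed.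

Lemma exp_le x y : x <= y -> exp x <= exp y.
Proof. by move=> [H|->]; [left; apply: exp_increasing|right]. Qed.

Lemma trunc_log_le p : (0 < p)%N -> INR (trunc_log 2 p) <= 2 * ln (INR p).
Proof.
move=> p0; have [l2 _] := ln2_bounds.
have H : 2 ^ trunc_log 2 p <= INR p.
  rewrite -[2]/(INR 2) -INR_expn; apply: INR_le_leq; exact: trunc_logP.
have : ln (2 ^ trunc_log 2 p) <= ln (INR p).
  by apply: ln_le H; apply: pow_lt; lra.
rewrite ln_pow; last lra.
have := pos_INR (trunc_log 2 p); nra.
Qed.

(* [tuned_rate] and [tuned_pow] hold for 2^j close to (ln n)^(eps/4). *)
Record tuned (eps : R) (n j : nat) : Prop := Tuned {
  tuned_n : (13 <= n)%N;
  tuned_j : (2 <= j)%N;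
  tuned_s : (4 ^ j < n)%N;
  tuned_ln : 1 <= ln (INR n);
  tuned_lnln : 0 < ln (ln (INR n)) <= ln (INR n);
  tuned_rate : eps * ln (ln (INR n)) <= 8 * INR j.-1;
  tuned_pow : INR (4 ^ j) <= Rpower (ln (INR n)) eps;
  tuned_lin : INR (4 ^ j) <= ln (INR n)
}.

Lemma exists_tuned eps : 0 < eps -> eps < 1 ->
  exists (n0 : nat) (jf : nat -> nat), forall n, (n0 <= n)%N -> tuned eps n (jf n).
Proof.
move=> e0 e1; have [l2 l21] := ln2_bounds.
(* [ln (ln n) >= B] amounts to [r >= 4] for the real number r whose floor is j; then
   [j - 1 >= r - 2 >= r / 2], which yields [tuned_rate]. *)
pose B := 16 * ln 2 / eps.
have B8 : 8 < B.
  by rewrite /B; apply: (Rmult_lt_reg_r eps) => //; field_simplify; [nra|lra].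
pose X := exp (exp B).
(* Before rounding down, [2 ^ j] would be exactly [(ln n)^(eps/4)]. *)
exists (Z.to_nat (up X)), (fun n => Z.to_nat (Int_part (eps * ln (ln (INR n)) / (4 * ln 2)))).
move=> n nX.
have Xn : X <= INR n.
  have [H _] := archimed X.
  apply: Rle_trans (INR_le_leq nX).
  rewrite INR_IZR_INZ Z2Nat.id; first lra.
  apply: le_IZR; have := exp_pos (exp B); rewrite -/X /=; lra.
have eB : 1 + B <= exp B by apply: exp_ineq1_le.
have eX : 1 + exp B <= X by apply: exp_ineq1_le.
have X0 : 0 < X by lra.
set x := ln (INR n); set y := ln x.
have xB : exp B <= x by rewrite /x -(ln_exp (exp B)); apply: ln_le.
have x1 : 1 <= x by lra.
have yB : B <= y by rewrite /y -(ln_exp B); apply: ln_le; [apply: exp_pos|].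
have yx : y <= x by have := @ln_le_sub1 x; rewrite -/y; lra.
have xn : x <= INR n - 1 by apply: ln_le_sub1; lra.
set r := eps * y / (4 * ln 2).
have r4 : 4 <= r.
  rewrite /r; apply: (Rmult_le_reg_r (4 * ln 2)); first lra.
  have -> : eps * y / (4 * ln 2) * (4 * ln 2) = eps * y by field; lra.
  have : eps * B = 16 * ln 2 by rewrite /B; field; lra.
  nra.
set j := Z.to_nat (Int_part r).
have [f1 f2] := base_Int_part r.
have jr : INR j = IZR (Int_part r).
  rewrite INR_IZR_INZ Z2Nat.id //; apply: le_IZR; lra.
have j2 : (2 <= j)%N.
  by apply/leP/INR_le; rewrite jr /=; lra.
have j1 : INR j.-1 = INR j - 1.
  by case: (j) j2 => // i _; rewrite S_INR /=; lra.
have p4 : INR (4 ^ j) <= exp (eps * y / 2).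
  rewrite INR_expn (_ : INR 4 = 2 * 2); last by rewrite /=; lra.
  rewrite -(exp_ln ((2 * 2) ^ j)); last by apply: pow_lt; lra.
  rewrite ln_pow; last lra.
  rewrite ln_mult; [|lra|lra].
  have E : eps * y / 2 = r * (ln 2 + ln 2) by rewrite /r; field; lra.
  have [H|H] := Rle_lt_or_eq_dec (INR j * (ln 2 + ln 2)) (eps * y / 2) ltac:(rewrite E; nra).
    by left; apply: exp_increasing.
  by rewrite H; lra.
have ey : eps * y <= y by nra.
have px : INR (4 ^ j) <= x.
  have ex : exp y = x by apply: exp_ln; lra.
  by apply: Rle_trans p4 _; rewrite -ex; apply: exp_le; nra.
split=> //.
- apply/leP/INR_le; have -> : INR 13 = 13 by rewrite /=; lra.
  have : 16 <= x.
    apply: Rle_trans px; have -> : 16 = INR (4 ^ 2) by rewrite /=; lra.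
    by apply: INR_le_leq; rewrite leq_exp2l.
  lra.
- by apply/ltP/INR_lt; lra.
- by rewrite -/x -/y; split; lra.
- rewrite j1 jr -/x -/y.
  have : eps * y = r * (4 * ln 2) by rewrite /r; field; lra.
  nra.
- apply: Rle_trans p4 _; rewrite /Rpower -/x -/y; apply: exp_le; nra.
Qed.

End Tuned.

(** Number of transmission levels. Since [2 ^ ladder D] exceeds D, the centre of every walk lies
    between 1 and [ladder D]. *)
Definition ladder (D : nat) := (trunc_log 2 D).+1.
(** For [j >= 2], the least k with [3 * ladder n < k * j.-1]. A phase multiplies the survival
    probability of a root by at most [2^-(j-1)], so k phases bring it below [n^-3]. *)
Definition rounds (n j : nat) := (3 * ladder n %/ j.-1).+1.

Section Costs.
Local Open Scope R_scope.
Variables (eps : R) (n D j : nat).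
Hypotheses (e0 : 0 < eps) (e1 : eps < 1) (P : tuned eps n j).
Hypotheses (D2 : (2 <= D)%N) (Dn : (D <= n)%N).

Let x := ln (INR n).
Let y := ln x.
Let u := x / (eps * y).
Let relay_slots := (200 * (ladder D + 6 * ladder n))%N.

(** From [ladder n <= 3x] and [j - 1 >= eps * y / 8] the quotient is at most [72 * u]; the rounding
    term 1 is absorbed because [u >= 1]. *)
Lemma rounds_le : INR (rounds n j) <= 73 * u.
Proof.
case: P => n13 j2 _ x1 [y0 yx] rate _ _; rewrite -/x -/y in x1 y0 yx rate.
have ey : 0 < eps * y by apply: Rmult_lt_0_compat.
have L3 : INR (ladder n) <= 3 * x.
  have := @trunc_log_le n (ltac:(by apply: leq_trans n13)).
  by rewrite /ladder S_INR -/x; lra.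
have u1 : 1 <= u.
  by apply: (Rmult_le_reg_r (eps * y)) => //; rewrite /u; field_simplify; [nra|nra].
rewrite /rounds S_INR; set q := (_ %/ _)%N.
have H : INR q * INR j.-1 <= 3 * INR (ladder n).
  rewrite -INR_muln (_ : 3 = INR 3) -?INR_muln; last by rewrite INR_IZR_INZ.
   apply: INR_le_leq; exact: leq_trunc_div.
have q0 := pos_INR q.
suff : INR q <= 72 * u by lra.
apply: (Rmult_le_reg_r (eps * y)) => //.
have -> : 72 * u * (eps * y) = 72 * x by rewrite /u; field; lra.
nra.
Qed.

Lemma relay_slots_le : INR relay_slots <= 4200 * x.
Proof.
case: P => n13 _ _ x1 _ _ _ _; rewrite -/x in x1.
have L3 : INR (ladder n) <= 3 * x.
  have := @trunc_log_le n (ltac:(by apply: leq_trans n13)).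
  by rewrite /ladder S_INR -/x; lra.
have D3 : INR (ladder D) <= INR (ladder n).
  by apply: INR_le_leq; rewrite ltnS; apply: leq_trunc_log.
rewrite /relay_slots INR_muln INR_addn INR_muln.
have -> : INR 200 = 200 by rewrite INR_IZR_INZ.
have -> : INR 6 = 6 by rewrite INR_IZR_INZ.
lra.
Qed.

(** The term [3 * 4 ^ j] pays for listening once per hop kind in every sweep; by [tuned_lin] it
    stays below the O(ln n) cost of the relays. *)
Lemma budget_le :
  INR (rounds n j * (4 * relay_slots + 3 * 4 ^ j + 6)) <=
  12000000 * energy_bound eps n.
Proof.
have Hk := rounds_le; have HT := relay_slots_le.
case: P => n13 j2 _ x1 [y0 yx] rate _ sx; rewrite -/x -/y in x1 y0 yx rate sx.
have ey : 0 < eps * y by apply: Rmult_lt_0_compat.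
have -> : energy_bound eps n = u * x.
  by rewrite /energy_bound -/x -/y /u /=; field; lra.
rewrite (INR_muln (rounds n j)) (INR_addn (_ + _)) (INR_addn (4 * _)).
rewrite (INR_muln 4) (INR_muln 3).
have -> : INR 4 = 4 by rewrite INR_IZR_INZ.
have -> : INR 3 = 3 by rewrite INR_IZR_INZ.
have -> : INR 6 = 6 by rewrite INR_IZR_INZ.
have k0 := pos_INR (rounds n j); have T0 := pos_INR relay_slots.
have s0 := pos_INR (4 ^ j).
apply: (Rle_trans _ (73 * u * (16809 * x))).
  by apply: Rmult_le_compat; lra.
have u0 : 0 <= u * x by nra.
lra.
Qed.

(** The factor [(ladder D).+1] is the width of a step, which is O(ln D) because [ln D >= ln 2]. The
    factors 73, 25215 and 6 multiply to less than 12000000, which fixes the constant of the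
    theorem. *)
Lemma slots_le :
  INR (rounds n j * (((4 ^ j).+1 * (2 * n + 1)) * (relay_slots + 2) + 3)
       * (ladder D).+1) <=
  12000000 * time_bound eps n D.
Proof.
have Hk := rounds_le; have HT := relay_slots_le.
case: P => n13 j2 _ x1 [y0 yx] rate sp _; rewrite -/x -/y in x1 y0 yx rate sp.
set p := Rpower x eps in sp.
have ey : 0 < eps * y by apply: Rmult_lt_0_compat.
have [l2 l21] := ln2_bounds.
have tE : time_bound eps n D = INR n * ln (INR D) * (x * p) * u.
  rewrite /time_bound -/x -/y Rpower_plus -/p (_ : Rpower x 2 = x * x).
    by rewrite /u; field; lra.
  by rewrite -[2]/(INR 2) Rpower_pow /=; lra.
have D0 : ln 2 <= ln (INR D) by apply: ln_le; [lra|exact: (@INR_le_leq 2)].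
have W : INR (ladder D).+1 <= 6 * ln (INR D).
  have := @trunc_log_le D (ltac:(by apply: leq_trans D2)).
  by rewrite !S_INR; lra.
have n1 : 13 <= INR n.
  by have := INR_le_leq n13; rewrite (INR_IZR_INZ 13).
have s1 : 1 <= INR (4 ^ j) by apply: (@INR_le_leq 1); rewrite expn_gt0.
have p1 : 1 <= p by lra.
have B : INR (((4 ^ j).+1 * (2 * n + 1)) * (relay_slots + 2) + 3) <=
    25215 * (p * INR n * x).
  rewrite (INR_addn (_ * _ * _)) (INR_muln (_ * _)) (INR_muln (4 ^ j).+1).
  rewrite (INR_addn (2 * n)) (INR_muln 2) (INR_addn relay_slots) S_INR.
  have -> : INR 3 = 3 by rewrite INR_IZR_INZ.
  have -> : INR 2 = 2 by rewrite INR_IZR_INZ.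
  have -> : INR 1 = 1 by [].
  have T0 := pos_INR relay_slots.
  apply: (Rle_trans _ ((2 * p) * (3 * INR n) * (4202 * x) + 3 * (1 * 1 * 1))).
    apply: Rplus_le_compat; last lra.
    apply: Rmult_le_compat; [nra|lra| |lra].
    by apply: Rmult_le_compat; lra.
  have : 1 * 1 * 1 <= p * INR n * x.
    by apply: Rmult_le_compat; [lra|lra| |lra]; apply: Rmult_le_compat; lra.
  lra.
rewrite [INR (_ * (ladder D).+1)]INR_muln [INR (rounds n j * _)]INR_muln.
have k0 := pos_INR (rounds n j); have W0 := pos_INR (ladder D).+1.
have B0 := pos_INR (((4 ^ j).+1 * (2 * n + 1)) * (relay_slots + 2) + 3)%N.
apply: (Rle_trans _ (73 * u * (25215 * (p * INR n * x)) * (6 * ln (INR D)))).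
  apply: Rmult_le_compat => //; first by apply: Rmult_le_pos.
  by apply: Rmult_le_compat.
rewrite tE.
have : 0 <= INR n * ln (INR D) * (x * p) * u.
  have u0 : 0 <= u by lra.
  apply: Rmult_le_pos => //; apply: Rmult_le_pos; last nra.
  by apply: Rmult_le_pos; lra.
lra.
Qed.

End Costs.

From mathcomp Require Import all_order all_algebra.
From mathcomp Require Import zify ring lra.

(** * The protocol as a local state machine *)

Inductive hop := Down of nat | Across | Up of nat.

(* Every step lasts [width] slots and consumes [chunk] fresh private bits. *)
Inductive step := Sample | SelfRoot | Commit | Ask of hop | Probe | Close.

Inductive role := Off | Sending | Walk of nat.

(* A label, with the input of the root from which the label was inherited. *)
Definition mark := (nat * option nat)%type.

(* [cur] is the labelling of the previous phase and [pend] the one under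
   construction; [told] lists the kinds of relay in which the vertex has already
   sent since it got its pending label.  [fail] and [spent] are ghost fields: no
   action depends on them. *)
Record node := Node {
  inp : option nat;
  cur : mark;
  pend : option mark;
  told : seq nat;
  duty : role;
  fail : bool;
  spent : nat
}.

Definition set_pend t q :=
  Node (inp q) (cur q) t (told q) (duty q) (fail q) (spent q).
Definition set_told s q :=
  Node (inp q) (cur q) (pend q) s (duty q) (fail q) (spent q).
Definition set_duty r q :=
  Node (inp q) (cur q) (pend q) (told q) r (fail q) (spent q).
Definition set_fail b q :=
  Node (inp q) (cur q) (pend q) (told q) (duty q) b (spent q).
Definition charge c q :=
  Node (inp q) (cur q) (pend q) (told q) (duty q) (fail q) (c + spent q).
Definition commit q :=
  Node (inp q) (odflt (cur q) (pend q)) None [::] Off (fail q) (spent q).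

Definition start (i : option nat) := Node i (0, i) None [::] Off false 0.

Definition kind (h : hop) : nat :=
  match h with Down _ => 0 | Across => 1 | Up _ => 2 end.

Definition from_layer (h : hop) (l : nat) : bool :=
  match h with Down i => l == i | Across => true | Up i => l == i.+1 end.

Definition to_layer (h : hop) (l : nat) : bool :=
  match h with Down i => l == i.+1 | Across => true | Up i => l == i end.

Definition layer q := (cur q).1.

Definition sends h q :=
  [&& isSome (pend q), kind h \notin told q & from_layer h (layer q)].

Definition hears h q := ~~ isSome (pend q) && to_layer h (layer q).

Definition packet q : nat := pickle (odflt (0, None) (pend q)).

Definition adopt (p : nat) q :=
  set_duty Off
    (set_pend (omap (fun t : mark => (t.1.+1, t.2)) (unpickle p)) q).

Definition react (lo hi : role) (f : feedback) q :=
  match f with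
  | FNone => q
  | FSilence => set_duty lo q
  | FNoise => set_duty hi q
  | FRecv p => adopt p q
  end.

(* Under uniform bits the value is i with probability 2^-i. *)
Definition level (b : seq bool) : nat := (index false b).+1.

Section Machine.
Variables (m j : nat).

Definition width := m.+1.
Definition chunk := m + j.

Definition coin (b : seq bool) : bool := all id (take j b).

(* In [Ask] all senders use slot 0, so that a listener without a sending
   neighbour pays one unit and skips the probes that follow. *)
Definition lact (st : step) (q : node) (b : seq bool) (o : nat) : action :=
  match st with
  | Ask h =>
      if o != 0 then Idle
      else if sends h q then Transmit (packet q)
      else if hears h q then Listen else Idle
  | Probe =>
      match duty q with
      | Off => Idle
      | Sending => if o == level b then Transmit (packet q) else Idle
      | Walk i => if o == i then Listen else Idle
      end
  | _ => Idle
  end.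

(** [Sample] always keeps a root with an input, that is, the source. In [Ask], noise starts a walk
    at level 1; the walk stays within the levels 1 to m, and [Close] turns an unfinished walk into a
    failure. *)
Definition lupd (st : step) (q : node) (b : seq bool) (fs : seq feedback) :=
  match st with
  | Sample =>
      if (layer q == 0) && (isSome (inp q) || coin b)
      then set_pend (Some (0, inp q)) q else q
  | SelfRoot =>
      if (layer q == 0) && ~~ isSome (pend q)
      then set_pend (Some (0, inp q)) q else q
  | Commit => commit q
  | Ask h =>
      if sends h q then set_told (kind h :: told q) (set_duty Sending q)
      else if hears h q then react Off (Walk 1) (nth FNone fs 0) q
      else q
  | Probe =>
      if duty q is Walk i
      then react (Walk (maxn 1 i.-1)) (Walk (minn m i.+1)) (nth FNone fs i) q
      else q
  | Close => set_fail (fail q || (if duty q is Walk _ then true else false))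
               (set_duty Off q)
  end.

Definition lstep st q b fs :=
  charge (\sum_(o < width) active (lact st q b o)) (lupd st q b fs).

Definition block {T} l t (s : seq T) := take l (drop (t * l) s).

Fixpoint local (p : seq step) i (bits : seq bool) (hist : seq feedback) t :=
  if t is t'.+1 then
    lstep (nth Commit p t') (local p i bits hist t')
      (block chunk t' bits) (block width t' hist)
  else start i.

(** A protocol has no memory besides its feedback, so the state is recomputed from the history. The
    length of the history is the current slot: its quotient by [width] is the step, its remainder
    the slot within the step. *)
Definition protocol_of (p : seq step) (cap : nat) : protocol :=
  Protocol (size p * chunk) (size p * width) cap
    (fun i bits hist =>
       let t := size hist %/ width in
       lact (nth Commit p t) (local p i bits hist t) (block chunk t bits)
         (size hist %% width))
    (fun i bits hist => (cur (local p i bits hist (size p))).2).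

(** * Global execution and its agreement with the slot-by-slot semantics *)

Section Global.
Variables (n : nat) (e : rel 'I_n).

Definition gfeed st (w : 'I_n -> seq bool) (g : 'I_n -> node) o v :=
  feedback_of e (fun u => lact st (g u) (w u) o) v.

Definition global_step st (w : 'I_n -> seq bool) (g : 'I_n -> node) v :=
  lstep st (g v) (w v) (mkseq (fun o => gfeed st w g o v) width).

Fixpoint execute (p : seq step) (r : 'I_n -> seq bool) (g : 'I_n -> node) :=
  if p is st :: p' then
    execute p' (fun v => drop chunk (r v)) (global_step st (fun v => take chunk (r v)) g)
  else g.

Lemma run_rcons p st r g :
  execute (rcons p st) r g =
  global_step st (fun v => block chunk (size p) (r v)) (execute p r g).
Proof.
elim: p r g => [|st' p IH] r g /=; first by rewrite /block; f_equal;
  apply: functional_extensionality => v; rewrite mul0n drop0.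
rewrite IH; f_equal; apply: functional_extensionality => v.
by rewrite /block drop_drop mulSn addnC.
Qed.

Section Simulation.
Variables (p : seq step) (cap : nat) (inpt : 'I_n -> option nat)
  (rnd : 'I_n -> seq bool).
Let P := protocol_of p cap.
Let hst := history P e inpt rnd.

Lemma size_history t v : size (hst t v) = t.
Proof. by elim: t => //= t IH; rewrite size_rcons IH. Qed.

Lemma local_hist (h h' : seq feedback) i b t :
  (t * width <= size h)%N -> local p i b (h ++ h') t = local p i b h t.
Proof.
elim: t => //= t IH le; rewrite IH; last by lia.
congr lstep; rewrite /block drop_cat.
case: ltnP => H; last by rewrite /width in le H *; lia.
by rewrite takel_cat // size_drop; lia.
Qed.

Definition local_at t v := local p (inpt v) (rnd v) (hst (t * width) v) t.

(** Actions within a step depend on the state at its beginning, on the bits of the step and on the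
    slot, so the feedbacks of one step can be computed at once. *)
Lemma history_prefix t o v : (o <= width)%N ->
  hst (t * width + o) v =
  hst (t * width) v ++
  mkseq (fun o' => gfeed (nth Commit p t)
    (fun u => block chunk t (rnd u)) (local_at t) o' v) o.
Proof.
elim: o v => [|o IH] v lto; first by rewrite addn0 cats0.
rewrite addnS mkseqS -rcons_cat -IH; last by lia.
rewrite /hst /= -/hst; congr (rcons _ _).
rewrite /gfeed; congr feedback_of; apply: functional_extensionality => u.
rewrite size_history divnMDl // modnMDl divn_small // modn_small // addn0.
by rewrite IH ?local_hist ?size_history //; lia.
Qed.

Lemma local_at_step t v :
  local_at t.+1 v =
  global_step (nth Commit p t) (fun u => block chunk t (rnd u)) (local_at t) v.
Proof.
rewrite /local_at mulSn addnC /= /global_step history_prefix // local_hist ?size_history //.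
congr lstep.
rewrite /block drop_size_cat ?size_history //.
by rewrite take_oversize // size_mkseq.
Qed.

Lemma local_at_run t : (t <= size p)%N ->
  local_at t = execute (take t p) rnd (fun v => start (inpt v)).
Proof.
elim: t => [|t IH] lt; first by rewrite take0.
apply: functional_extensionality => v.
rewrite local_at_step (take_nth Commit) // run_rcons IH; last by lia.
by rewrite size_takel //; lia.
Qed.

Lemma output_run v :
  output P e inpt rnd v =
  (cur (execute p rnd (fun v => start (inpt v)) v)).2.
Proof.
by rewrite -[in RHS](take_size p) -local_at_run.
Qed.

Lemma active_block t v :
  \sum_(o < width) active (action_at P e inpt rnd (t * width + o) v) =
  \sum_(o < width) active (lact (nth Commit p t) (local_at t v)
     (block chunk t (rnd v)) o).
Proof.
apply: eq_bigr => o _; congr (nat_of_bool (active _)).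
rewrite /action_at -/hst /= size_history divnMDl // modnMDl.
rewrite divn_small // modn_small // addn0 history_prefix; last by rewrite ltnW.
by rewrite local_hist // size_history.
Qed.

Lemma spent_lupd st q b fs : spent (lupd st q b fs) = spent q.
Proof.
case: st => [|||h||] //=; try by case: ifP.
  by case: ifP => // _; case: ifP => // _; case: nth.
by case: (duty q) => // i; case: nth.
Qed.

(** Identifies the ghost field [spent] with the true energy, so that energy can be bounded by
    invariants of the states. *)
Lemma energy_run_take t v : (t <= size p)%N ->
  \sum_(x < t * width) active (action_at P e inpt rnd x v) =
  spent (local_at t v).
Proof.
elim: t => [|t IH] lt; first by rewrite mul0n big_ord0.
rewrite -(big_mkord xpredT (fun x => nat_of_bool (active (action_at P e inpt rnd x v)))).
rewrite mulSn addnC (big_cat_nat (n := t * width)) ?leq_addr //.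
rewrite big_mkord IH; last by lia.
rewrite -[X in \sum_(X <= _ < _) _]add0n big_addn addKn big_mkord.
rewrite (eq_bigr (fun o : 'I_width => nat_of_bool (active (action_at P e inpt rnd (t * width + o) v)))); last first.
  by move=> o _; rewrite [(o + _)%N]addnC.
rewrite active_block local_at_step /global_step /lstep.
by rewrite -[RHS]/(_ + spent (lupd _ _ _ _))%N spent_lupd addnC.
Qed.

Lemma energy_run v :
  energy P e inpt rnd v = spent (execute p rnd (fun v => start (inpt v)) v).
Proof.
by rewrite /energy energy_run_take // local_at_run // take_size.
Qed.

End Simulation.
End Global.
End Machine.

(** * One relay *)

Variant feedback_spec (n : nat) (A : 'I_n -> action)
    (S : {set 'I_n}) : feedback -> Prop :=
  | FeedbackSilence of S = set0 : feedback_spec A S FSilence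
  | FeedbackRecv u p of S = [set u] & A u = Transmit p :
      feedback_spec A S (FRecv p)
  | FeedbackNoise of (1 < #|S|)%N : feedback_spec A S FNoise.

Lemma feedbackP n (e : rel 'I_n) A v : A v = Listen ->
  feedback_spec A [set u | e v u & isSome (sent (A u))]
    (feedback_of e A v).
Proof.
move=> Av; rewrite /feedback_of Av; set S := finset _.
case: ifP => [/eqP/cards0_eq ->|S0]; first by constructor.
case: ifP => [/cards1P[u Su]|S1]; last by constructor; case: #|S| S0 S1 => [|[]].
case: pickP => [w|/(_ u)]; last by rewrite Su set11.
rewrite {1}Su inE => /eqP ->.
have : u \in S by rewrite Su set11.
rewrite inE => /andP[_]; case Au: (A u) => //= [p] _.
exact: FeedbackRecv Su Au.
Qed.

Section Relay.
Variables (m j : nat) (m_gt0 : (0 < m)%N) (n : nat) (e : rel 'I_n).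
Implicit Types (g : 'I_n -> node) (h : hop).

Definition senders h g v := [set u | e v u & sends h (g u)].

(** Invariant after [Ask] and t probes, relative to the configuration g before the relay. Each step
    has at most one active slot per vertex, hence the bound t+1. A walking listener has at least two
    senders, since a single one is already received in [Ask]. *)
Variant midway h g (t : nat) v : node -> Prop :=
  | MidSend c of sends h (g v) & (c <= spent (g v) + t.+1)%N :
    midway h g t v (Node (inp (g v)) (cur (g v)) (pend (g v))
      (kind h :: told (g v)) Sending (fail (g v)) c)
  | MidDeaf c of ~~ sends h (g v) & hears h (g v) & senders h g v = set0
      & (c <= spent (g v) + 1)%N :
    midway h g t v (Node (inp (g v)) (cur (g v)) None (told (g v)) Off
      (fail (g v)) c)
  | MidGot c u x of ~~ sends h (g v) & hears h (g v) & u \in senders h g v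
      & pend (g u) = Some x & (c <= spent (g v) + t.+1)%N :
    midway h g t v (Node (inp (g v)) (cur (g v)) (Some (x.1.+1, x.2))
      (told (g v)) Off (fail (g v)) c)
  | MidWalk c i of ~~ sends h (g v) & hears h (g v) & (1 < #|senders h g v|)%N
      & (0 < i <= m)%N & (c <= spent (g v) + t.+1)%N :
    midway h g t v (Node (inp (g v)) (cur (g v)) None (told (g v)) (Walk i)
      (fail (g v)) c)
  | MidOut c of ~~ sends h (g v) & ~~ hears h (g v) & (c <= spent (g v))%N :
    midway h g t v (Node (inp (g v)) (cur (g v)) (pend (g v)) (told (g v)) Off
      (fail (g v)) c).

Definition quiet g := forall v, duty (g v) = Off.

Lemma sum_active_le1 (F : nat -> action) w i :
  (forall o, o != i -> ~~ active (F o)) -> (\sum_(o < w) active (F o) <= 1)%N.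
Proof.
move=> F0; case: (ltnP i w) => iw; last first.
  rewrite big1 // => o _; rewrite (negbTE (F0 _ _)) //.
  by apply: contraTneq (ltn_ord o) => ->; rewrite -leqNgt.
rewrite (bigD1 (Ordinal iw)) //= big1 ?addn0; first by case: active.
by move=> o neq; rewrite (negbTE (F0 _ _)).
Qed.

Lemma sends_hears h q : hears h q -> ~~ sends h q.
Proof. by rewrite /sends /hears => /andP[/negbTE ->]. Qed.

Lemma sendsS h q : sends h q -> exists x, pend q = Some x.
Proof. by rewrite /sends; case: (pend q) => [x|] //; exists x. Qed.

Lemma unpickle_packet q x : pend q = Some x -> unpickle (packet q) = Some x.
Proof. by rewrite /packet => ->; rewrite pickleK. Qed.

Lemma ask_midway h g w v : quiet g -> midway h g 0 v (global_step m j e (Ask h) w g v).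
Proof.
move=> Q; rewrite /global_step /lstep.
set c := \sum_(o < _) _.
have c1 : (c <= 1)%N.
  by rewrite /c; apply: (@sum_active_le1 (lact (Ask h) (g v) (w v)) _ 0) => o /= ->.
rewrite /charge /=; case: ifPn => [sv|nsv] /=.
  by apply: MidSend => //; rewrite addnC leq_add.
case: ifPn => [hv|nhv] /=; last first.
  rewrite Q; apply: MidOut => //.
  by rewrite /c big1 // => o _ /=; rewrite (negbTE nsv) (negbTE nhv) if_same.
have nv : pend (g v) = None by case/andP: hv; case: pend.
rewrite /gfeed.
set A := fun u => _.
have Av : A v = Listen by rewrite /A /= (negbTE nsv) hv.
have SE : [set u | e v u & isSome (sent (A u))] = senders h g v.
  by apply/setP=> u; rewrite !inE /A /=; case: sends => //; case: hears.
case: feedbackP => //; rewrite SE.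
- move=> S0; rewrite /= nv; apply: MidDeaf => //; lia.
- move=> u p Su; have us : u \in senders h g v by rewrite Su set11.
  move: (us); rewrite inE => /andP[_ su]; rewrite /A /= su => -[<-].
  have [x nu] := sendsS su; rewrite /= (unpickle_packet nu).
  by apply: (MidGot (u := u)) => //; lia.
- by move=> S1; rewrite /= nv; apply: MidWalk => //; lia.
Qed.

Lemma probe_midway h g t g1 w v : (forall v, midway h g t v (g1 v)) ->
  midway h g t.+1 v (global_step m j e Probe w g1 v).
Proof.
move=> M; rewrite /global_step /lstep.
set c := \sum_(o < _) _.
have c1 : (c <= 1)%N.
  pose i := match duty (g1 v) with Off => 0 | Sending => level (w v) | Walk i => i end.
  rewrite /c; apply: (@sum_active_le1 (lact Probe (g1 v) (w v)) _ i) => o.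
  by rewrite /i /=; case: duty => [|/negbTE ->|? /negbTE ->].
have cE : duty (g1 v) = Off -> c = 0.
  by rewrite /c /lact => ->; rewrite big1.
rewrite /charge; clearbody c; move Efs: (mkseq _ _) => fs; rewrite /=.
move Eq : (g1 v) (M v) => q Mq.
case: Mq Eq c1 cE => /=.
- by move=> d sv le Eq c1 _; apply: MidSend => //; lia.
- move=> d nsv hv S0 le Eq _ ->; [exact: MidDeaf|by rewrite Eq].
- move=> d u x nsv hv us nu le Eq _ ->; last by rewrite Eq.
  by apply: (MidGot (u := u)) => //; lia.
- move=> d i nsv hv S2 im le Eq c1 _.
  rewrite -Efs nth_mkseq; last by rewrite /width; lia.
  rewrite /gfeed; set A := fun u => _.
  have Av : A v = Listen by rewrite /A /= Eq /= eqxx.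
  case: feedbackP => // [_|u p Su Au|_] /=.
  + by apply: MidWalk => //; lia.
  + have : u \in [set u | e v u & isSome (sent (A u))] by rewrite Su set11.
    rewrite inE => /andP[evu _]; move: Au; rewrite /A /=.
    (* Transmitting forces the case [MidSend]: walking vertices only listen, and the remaining ones
       are off duty. *)
    case: (M u) => //=; last first.
      by move=> d' i' _ _ _ _ _; case: ifP.
    move=> d' su _; case: ifP => // _ [<-].
    have [x nu] := sendsS su.
    rewrite /adopt /= /packet /= nu pickleK.
    apply: (MidGot (u := u)) => //; [by rewrite inE evu|lia].
  + by apply: MidWalk => //; lia.
- by move=> d nsv nhv le Eq _ ->; [exact: MidOut|rewrite Eq].
Qed.

End Relay.

(** * Sequences of relays: invariants and amortised energy *)

Section Chain.
Variables (m j T : nat) (m_gt0 : (0 < m)%N) (n : nat) (e : rel 'I_n).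
Implicit Types (g : 'I_n -> node) (h : hop).

Lemma run_cat p1 p2 r g :
  execute m j e (p1 ++ p2) r g =
  execute m j e p2 (fun v => drop (size p1 * chunk m j) (r v)) (execute m j e p1 r g).
Proof.
elim: p1 r g => [|st p1 IH] r g /=.
  by congr execute; apply: functional_extensionality => v; rewrite mul0n drop0.
rewrite IH; congr execute; apply: functional_extensionality => v.
by rewrite drop_drop mulSn addnC.
Qed.

Definition relay h := Ask h :: nseq T Probe ++ [:: Close].

(** The failure case leaves the cost open, because energy is only bounded on runs without
    failures. *)
Variant relayed h g v : node -> Prop :=
  | RelaySend c of sends h (g v) & (c <= spent (g v) + T.+1)%N :
    relayed h g v (Node (inp (g v)) (cur (g v)) (pend (g v))
      (kind h :: told (g v)) Off (fail (g v)) c)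
  | RelayDeaf c of ~~ sends h (g v) & hears h (g v) & senders e h g v = set0
      & (c <= spent (g v) + 1)%N :
    relayed h g v (Node (inp (g v)) (cur (g v)) None (told (g v)) Off
      (fail (g v)) c)
  | RelayGot c u x of ~~ sends h (g v) & hears h (g v) & u \in senders e h g v
      & pend (g u) = Some x & (c <= spent (g v) + T.+1)%N :
    relayed h g v (Node (inp (g v)) (cur (g v)) (Some (x.1.+1, x.2))
      (told (g v)) Off (fail (g v)) c)
  | RelayFail c of ~~ sends h (g v) & hears h (g v) :
    relayed h g v (Node (inp (g v)) (cur (g v)) None (told (g v)) Off true c)
  | RelayOut c of ~~ sends h (g v) & ~~ hears h (g v) & (c <= spent (g v))%N :
    relayed h g v (Node (inp (g v)) (cur (g v)) (pend (g v)) (told (g v)) Off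
      (fail (g v)) c).

Lemma probes_midway h g t k g1 r : (forall v, midway m e h g t v (g1 v)) ->
  forall v, midway m e h g (t + k) v (execute m j e (nseq k Probe) r g1 v).
Proof.
elim: k t g1 r => [|k IH] t g1 r M v; first by rewrite addn0.
by rewrite addnS -addSn; apply: IH => u; apply: probe_midway.
Qed.

Lemma close_relayed h g g1 w v : midway m e h g T v (g1 v) ->
  relayed h g v (global_step m j e Close w g1 v).
Proof.
rewrite /global_step /lstep big1 // /charge /=; case => [c|c|c u x|c i|c] /=; rewrite add0n ?orbF.
- exact: RelaySend.
- exact: RelayDeaf.
- exact: RelayGot.
- by rewrite orbT => *; apply: RelayFail.
- exact: RelayOut.
Qed.

Lemma run_relay h r g v : quiet g -> relayed h g v (execute m j e (relay h) r g v).
Proof.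
move=> Q; rewrite /relay /= run_cat /=; apply: close_relayed.
by apply: (@probes_midway _ _ 0) => u; apply: ask_midway.
Qed.

(** Abstracts from the random bits: it keeps only that each relay had one of the outcomes listed in
    [relayed], which makes the analysis of sweeps deterministic. *)
Fixpoint chain hs g g' : Prop :=
  if hs is h :: hs' then
    exists2 g1, (forall v, relayed h g v (g1 v)) & chain hs' g1 g'
  else g' = g.

Lemma relayed_quiet h g g' : (forall v, relayed h g v (g' v)) -> quiet g'.
Proof. by move=> R v; case: (R v). Qed.

Definition relays hs := flatten (map relay hs).

Lemma run_relays hs r g : quiet g -> chain hs g (execute m j e (relays hs) r g).
Proof.
elim: hs r g => [|h hs IH] r g Q //.
rewrite -[relays _]/(relay h ++ relays hs) run_cat.
exists (execute m j e (relay h) r g); first by move=> v; apply: run_relay.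
by apply: IH; apply: (@relayed_quiet h g) => v; apply: run_relay.
Qed.

Lemma chain_cat hs1 hs2 g g' :
  chain (hs1 ++ hs2) g g' <-> exists2 g1, chain hs1 g g1 & chain hs2 g1 g'.
Proof.
elim: hs1 g => [|h hs1 IH] g /=.
  by split=> [c|[g1 -> //]]; exists g.
split=> [[g1 R /IH[g2 c1 c2]]|[g2 [g1 R c1] c2]].
  by exists g2 => //; exists g1.
by exists g1 => //; apply/IH; exists g2.
Qed.

Definition ok g := forall v, ~~ fail (g v).
Definition known g v := isSome (pend (g v)).

(* Amortisation: a relay costs a vertex T+1 units only if it lengthens [told] or
   fills [pend]. *)
Definition credit q := (T.+1 * size (told q) + T * isSome (pend q))%N.

Record frame g g' : Prop := Frame {
  frame_inp : forall v, inp (g' v) = inp (g v);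
  frame_cur : forall v, cur (g' v) = cur (g v);
  frame_pend : forall v, known g v -> pend (g' v) = pend (g v)
}.

Lemma frame_trans g1 g2 g3 : frame g1 g2 -> frame g2 g3 -> frame g1 g3.
Proof.
move=> [i1 c1 p1] [i2 c2 p2]; split=> v; rewrite ?i2 ?c2 // => k.
by rewrite p2 /known ?p1.
Qed.

Lemma frame_known g g' v : frame g g' -> known g v -> known g' v.
Proof. by move=> [_ _ fp] k; rewrite /known fp. Qed.

(** [sound_reach] justifies sending only once per kind: no receiver of an earlier sending is still
    without a label. The last two fields say that the pending labels are a partial good labelling
    that carries the inputs of its roots. *)
Record sound g : Prop := Sound {
  sound_quiet : quiet g;
  sound_told : forall v, uniq (told (g v)) && all (fun k => k < 3)%N (told (g v));
  sound_reach : forall u w h, kind h \in told (g u) -> e u w ->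
    from_layer h (layer (g u)) -> to_layer h (layer (g w)) -> known g w;
  sound_root : forall v x, pend (g v) = Some (0, x) ->
    layer (g v) = 0 /\ x = inp (g v);
  sound_link : forall v l x, pend (g v) = Some (l.+1, x) ->
    exists2 u, e v u & pend (g u) = Some (l, x)
}.

Section OneRelay.
Variables (h : hop) (g g' : 'I_n -> node).
Hypothesis R : forall v, relayed h g v (g' v).

Lemma relayed_fail v : fail (g v) -> fail (g' v).
Proof. by case: (R v). Qed.

Lemma relayed_frame : frame g g'.
Proof.
split=> v; try by case: (R v).
by rewrite /known; case: (R v) => //= [c _ /andP[nk _] _ _|c u x _ /andP[nk _] _ _ _|c _ /andP[nk _]];
  case: pend nk.
Qed.

Hypothesis O : ok g'.

Lemma relayed_ok : ok g.
Proof. by move=> v; apply: contra (O v); apply: relayed_fail. Qed.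

Lemma relayed_new v t : ~~ known g v -> pend (g' v) = Some t ->
  hears h (g v) /\ exists u x, [/\ e v u, pend (g u) = Some x & t = (x.1.+1, x.2)].
Proof.
rewrite /known; case: (R v) => //=.
- by move=> c sv _ /negbTE nk nt; rewrite nt in nk.
- move=> c u x _ hv; rewrite inE => /andP[evu _] nu _ _ [<-]; split=> //.
  by exists u, x.
- by move=> c _ _ _ /negbTE nk nt; rewrite nt in nk.
Qed.

Lemma relayed_told v : told (g' v) = if sends h (g v) then kind h :: told (g v)
  else told (g v).
Proof. by case: (R v) => /= [? ->|? /negbTE->|? ? ? /negbTE->|? /negbTE->|? /negbTE->]. Qed.

(** A sender pays T+1, matched by a new entry of [told]. A listener that gets a label charges T to
    [pend] and one unit to the fact that the relay addresses its layer; a listener without senders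
    needs only that unit. *)
Lemma relayed_energy v :
  (spent (g' v) + credit (g v) <=
   spent (g v) + credit (g' v) + to_layer h (layer (g v)))%N.
Proof.
clear m_gt0; have := O v; rewrite /credit.
case: (R v) => //= [c _ le _|c _ /andP[+ ->] _|c u x _ /andP[+ ->] _ _|c _ _].
- by rewrite mulnS => *; lia.
- by case: pend => //= _ *; lia.
- by case: pend => //= _ *; lia.
- by move=> *; lia.
Qed.

Lemma relayed_hear u w : e w u -> sends h (g u) -> hears h (g w) -> known g' w.
Proof.
move=> ewu su hw; have := O w; rewrite /known; case: (R w) => //=.
- by move=> c; rewrite (negbTE (sends_hears hw)).
- by move=> c _ _ S0 _; move: (in_set0 u); rewrite -S0 inE ewu su.
- by move=> c _; rewrite hw.
Qed.

End OneRelay.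

Hypothesis e_sym : symmetric e.

(** Either u sends now and w hears it, or u has sent in this kind before and [sound_reach] already
    gives w a label. *)
Lemma relayed_progress h g g' u w : (forall v, relayed h g v (g' v)) -> ok g' ->
  sound g -> known g u -> e u w -> from_layer h (layer (g u)) ->
  to_layer h (layer (g w)) -> known g' w.
Proof.
move=> R O S ku euw fu tw; have F := relayed_frame R.
have [kw|nkw] := boolP (known g w); first exact: frame_known F kw.
case: (boolP (kind h \in told (g u))) => [tu|ntu].
  by rewrite (sound_reach S tu euw) in nkw.
apply: (relayed_hear R O (u := u)); rewrite 1?e_sym //.
  by rewrite /sends ntu fu /= andbT.
by rewrite /hears nkw.
Qed.

(** This is why [told] may store kinds instead of hops: for a vertex of fixed layer, the kind
    determines the hop in which it sends. *)
Lemma kind_inj h h' l : kind h = kind h' -> from_layer h l -> from_layer h' l ->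
  h = h'.
Proof.
by case: h h' => [i||i] [i'||i'] //= _ /eqP -> /eqP => [->|[->]].
Qed.

Lemma relayed_sound h g g' : (forall v, relayed h g v (g' v)) -> ok g' ->
  sound g -> sound g'.
Proof.
move=> R O S; have F := relayed_frame R.
have L v : layer (g' v) = layer (g v) by rewrite /layer (frame_cur F).
split.
- exact: relayed_quiet R.
- move=> v; rewrite (relayed_told R); case: ifP => [/and3P[_ nt _]|_] /=.
    case/andP: (sound_told S v) => -> ->; rewrite nt /= andbT.
    by case: h {R nt}.
  exact: sound_told.
- move=> u w h'; rewrite (relayed_told R) !L => k euw fu tw.
  suff [ku|//] : (kind h' \in told (g u)) \/ known g' w.
    exact: frame_known F (sound_reach S ku euw fu tw).
  move: k; case: ifP => [su|_]; last by left.
  rewrite inE => /orP[/eqP kk|]; last by left.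
  right; case/and3P: (su) => ku _ fu'.
  rewrite (kind_inj kk fu fu') in tw.
  exact: (relayed_progress R O S ku euw fu' tw).
- move=> v x; have [kv|nkv] := boolP (known g v).
    by rewrite (frame_pend F kv) L (frame_inp F); apply: sound_root.
  by case/(relayed_new R nkv) => _ [u [t [_ _ []]]].
- move=> v l x; have [kv|nkv] := boolP (known g v).
    rewrite (frame_pend F kv) => /(sound_link S)[u evu pu]; exists u => //.
    by rewrite (frame_pend F) // /known pu.
  case/(relayed_new R nkv) => _ [u [[a b] [evu pu [-> ->]]]]; exists u => //.
  by rewrite (frame_pend F) // /known pu.
Qed.

Lemma chain_fail hs g g' v : chain hs g g' -> fail (g v) -> fail (g' v).
Proof.
elim: hs g => [|h hs IH] g /= => [->//|[g1 R c] f].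
exact: IH c (relayed_fail R f).
Qed.

Lemma chain_ok hs g g' : chain hs g g' -> ok g' -> ok g.
Proof. by move=> c O v; apply: contra (O v); apply: chain_fail c. Qed.

Lemma chain_frame hs g g' : chain hs g g' -> frame g g'.
Proof.
elim: hs g => [|h hs IH] g /= => [->//|[g1 R c]].
exact: frame_trans (relayed_frame R) (IH _ c).
Qed.

Lemma chain_sound hs g g' : chain hs g g' -> ok g' -> sound g -> sound g'.
Proof.
elim: hs g => [|h hs IH] g /= => [->//|[g1 R c] O S].
by apply: (IH _ c O); apply: relayed_sound R _ S; apply: chain_ok c O.
Qed.

Lemma chain_energy hs g g' v : chain hs g g' -> ok g' ->
  (spent (g' v) + credit (g v) <= spent (g v) + credit (g' v) +
   count (fun h => to_layer h (layer (g v))) hs)%N.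
Proof.
elim: hs g => [|h hs IH] g /= => [-> _|[g1 R c] O]; first by rewrite addn0.
clear m_gt0; have := IH _ c O; have := relayed_energy R (chain_ok c O) v.
rewrite /layer (frame_cur (relayed_frame R)); lia.
Qed.

(** Relays only hand out successors of labels, so a label 0 is older than the chain. *)
Lemma chain_nonroot hs g g' v x : chain hs g g' -> ok g' ->
  pend (g' v) = Some (0, x) -> pend (g v) = Some (0, x).
Proof.
elim: hs g => [|h hs IH] g /= => [->//|[g1 R c] O /(IH _ c O) p1].
have [kv|nkv] := boolP (known g v).
  by rewrite -(frame_pend (relayed_frame R) kv).
by case/(relayed_new R nkv): p1 => _ [u [t [_ _ []]]].
Qed.

End Chain.

Lemma connect_last (T : finType) (d : rel T) a b : connect d a b ->
  b = a \/ exists2 c, connect d a c & d c b.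
Proof.
case/connectP=> p; elim/last_ind: p => [|p x _] /=; first by left.
rewrite last_rcons rcons_path => /andP[pp dx] ->; right.
by exists (last a p) => //; apply/connectP; exists p.
Qed.

(** * Sweeps and the spreading of labels between clusters *)

Section Sweep.
Variables (T n : nat) (e : rel 'I_n) (e_sym : symmetric e) (lay : 'I_n -> nat).
Implicit Types (g : 'I_n -> node) (h : hop).

Local Notation chain := (chain T e).
Local Notation sound := (sound e).

(** The vertices reachable from a root along these edges are its cluster; clusters may overlap. *)
Definition down_edge : rel 'I_n := fun a b => e a b && (lay b == (lay a).+1).

(** Induction on the layers: the hop [Down k] comes after all hops above it, so the predecessor of u
    on its path from r is labelled by then. *)
Lemma down_sweep k g g' r u : chain (map Down (iota 0 k)) g g' -> ok g' ->
  sound g -> (forall v, layer (g v) = lay v) -> known g r ->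
  connect down_edge r u -> (lay u <= k)%N -> known g' u.
Proof.
elim: k g' u => [|k IH] g' u.
  move=> /= -> _ _ _ kr /connect_last[->//|[w _ /andP[_ /eqP ->]]].
  by rewrite ltn0.
rewrite -addn1 iotaD map_cat add0n => /chain_cat[g1 c1 [g2 R /= ->]] O S L kr cu.
have O1 := relayed_ok R O.
have F := relayed_frame R; have F1 := chain_frame c1.
case: (leqP (lay u) k) => [le _|lt le].
  exact: frame_known F (IH _ _ c1 O1 S L kr cu le).
case/connect_last: cu => [->|[w cw /andP[ewu /eqP luw]]].
  exact: frame_known F (frame_known F1 kr).
have lw : lay w = k by lia.
have L1 v : layer (g1 v) = lay v by rewrite /layer (frame_cur F1) -[LHS]/(layer _) L.
apply: (relayed_progress e_sym R O (u := w)) => //.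
- exact: chain_sound c1 O1 S.
- by apply: IH c1 O1 S L kr cw _; rewrite lw.
- by rewrite /= L1 lw.
- by rewrite /= L1 luw lw.
Qed.

(** The hops run from the deepest layer upwards, so the label climbs the path from w back to r one
    layer per hop. *)
Lemma up_sweep k g g' r w : chain (map Up (rev (iota 0 k))) g g' -> ok g' ->
  sound g -> (forall v, layer (g v) = lay v) -> known g w ->
  connect down_edge r w -> (lay w <= k)%N -> known g' r.
Proof.
elim: k g w => [|k IH] g w.
  move=> /= -> _ _ _ kw /connect_last[<-//|[u _ /andP[_ /eqP ->]]].
  by rewrite ltn0.
rewrite -[k.+1]addn1 iotaD rev_cat map_cat add0n /= => -[g1 R c1] O S L kw cw.
have O1 := chain_ok c1 O.
have F := relayed_frame R; have F1 := chain_frame c1.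
have L1 v : layer (g1 v) = lay v by rewrite /layer (frame_cur F) -[LHS]/(layer _) L.
have S1 := relayed_sound e_sym R O1 S.
rewrite addn1; case: (leqP (lay w) k) => [le _|lt le].
  exact: IH c1 O S1 L1 (frame_known F kw) cw le.
case/connect_last: cw => [<-|[u cu /andP[euw /eqP luw]]].
  exact: frame_known F1 (frame_known F kw).
have lu : lay u = k by lia.
have ku : known g1 u.
  apply: (relayed_progress e_sym R O1 S kw); rewrite 1?e_sym //= L.
    by rewrite luw lu.
  by rewrite lu.
by apply: IH c1 O S1 L1 ku cu _; rewrite lu.
Qed.

Definition sweep := map Down (iota 0 n) ++ Across :: map Up (rev (iota 0 n)).

Hypothesis lay_lt : forall v, (lay v < n)%N.

Lemma sweep_below g g' r u : chain sweep g g' -> ok g' ->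
  sound g -> (forall v, layer (g v) = lay v) -> known g r ->
  connect down_edge r u -> known g' u.
Proof.
move=> /chain_cat[g1 c1 c2] O S L kr cu; have O1 := chain_ok c2 O.
apply: frame_known (chain_frame c2) _.
by apply: down_sweep c1 O1 S L kr cu _; apply: ltnW.
Qed.

Lemma sweep_across g g' r u w r' : chain sweep g g' -> ok g' ->
  sound g -> (forall v, layer (g v) = lay v) -> known g r ->
  connect down_edge r u -> e u w -> connect down_edge r' w -> known g' r'.
Proof.
move=> /chain_cat[g1 c1 [g2 R c2]] O S L kr cu euw cw.
have O2 := chain_ok c2 O; have O1 := relayed_ok R O2.
have S1 := chain_sound e_sym c1 O1 S.
have S2 := relayed_sound e_sym R O2 S1.
have L1 v : layer (g1 v) = lay v.
  by rewrite /layer (frame_cur (chain_frame c1)) -[LHS]/(layer _) L.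
have L2 v : layer (g2 v) = lay v.
  by rewrite /layer (frame_cur (relayed_frame R)) -[LHS]/(layer _) L1.
have k1 : known g1 u by apply: down_sweep c1 O1 S L kr cu _; apply: ltnW.
have k2 : known g2 w by apply: (relayed_progress e_sym R O2 S1 k1).
by apply: up_sweep c2 O S2 L2 k2 cw _; apply: ltnW.
Qed.

(* Adjacency of clusters, each represented by a root. *)
Definition linked : rel 'I_n := fun a b => (lay b == 0) &&
  [exists u, exists w, [&& connect down_edge a u, e u w & connect down_edge b w]].

Definition sweeps t := flatten (nseq t sweep).

(** One sweep labels the root before the last one on the path, so the path can be shortened by one
    cluster per sweep. *)
Lemma spread t g g' v p : chain (sweeps t) g g' -> ok g' ->
  sound g -> (forall v, layer (g v) = lay v) -> path linked v p ->
  (size p <= t)%N -> known g (last v p) -> known g' v.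
Proof.
elim: t g p => [|t IH] g p; first by move=> /= -> _ _ _ _; case: p.
move=> /chain_cat[g1 c1 c2] O S L.
have O1 := chain_ok c2 O; have F1 := chain_frame c1.
have L1 u : layer (g1 u) = lay u by rewrite /layer (frame_cur F1) -[LHS]/(layer _) L.
have S1 := chain_sound e_sym c1 O1 S.
elim/last_ind: p => [|p b _] pp le kb.
  exact: frame_known (chain_frame c2) (frame_known F1 kb).
move: pp kb le; rewrite rcons_path last_rcons size_rcons => /andP[pp].
case/andP=> _ /existsP[u /existsP[w /and3P[cu euw cw]]] kb le.
apply: (IH g1 p c2 O S1 L1 pp) => //.
by apply: (sweep_across c1 O1 S L kb cw _ cu); rewrite e_sym.
Qed.

Lemma count_sweep l : (count (fun h => to_layer h l) sweep <= 3)%N.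
Proof.
rewrite /sweep count_cat /= !count_map count_rev.
have A : (count (preim Down (to_layer^~ l)) (iota 0 n) <= 1)%N.
  case: l => [|l]; first by rewrite (eq_count (a2 := pred0)) ?count_pred0.
  rewrite (eq_count (a2 := pred1 l)) ?count_uniq_mem ?iota_uniq ?leq_b1 // => i /=.
  by rewrite eqSS eq_sym.
have B : (count (preim Up (to_layer^~ l)) (iota 0 n) <= 1)%N.
  rewrite (eq_count (a2 := pred1 l)) ?count_uniq_mem ?iota_uniq ?leq_b1 // => i /=.
  by rewrite eq_sym.
lia.
Qed.

Lemma count_sweeps t l :
  (count (fun h => to_layer h l) (sweeps t) <= 3 * t)%N.
Proof.
elim: t => [|t IH] //; rewrite -[sweeps _]/(sweep ++ sweeps t) count_cat.
have := count_sweep l; lia.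
Qed.

End Sweep.

Lemma size_sweep n : size (sweep n) = (2 * n + 1)%N.
Proof. by rewrite /sweep size_cat /= !size_map size_rev size_iota; lia. Qed.

Lemma size_sweeps n s : size (sweeps n s) = (s * (2 * n + 1))%N.
Proof.
elim: s => [|s IH] //.
by rewrite -[sweeps _ _]/(sweep n ++ sweeps n s) size_cat IH size_sweep mulSn.
Qed.

(** * One phase *)

Section Phase.
Variables (m j T s : nat) (m_gt0 : (0 < m)%N) (n : nat) (e : rel 'I_n).
Variables (e_sym : symmetric e) (e_conn : connected_graph e).
Variables (src : 'I_n) (msg : nat).
Implicit Types (g : 'I_n -> node).

Local Notation chain := (chain T e).
Local Notation sound := (sound e).
Local Notation gstep := (global_step m j e).
Local Notation sweep := (sweep n).
Local Notation sweeps := (sweeps n).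

(* The last sweep starts with every root labelled and hence labels everybody. *)
Definition phase :=
  Sample :: relays T (sweeps s) ++ SelfRoot :: relays T sweep ++ [:: Commit].

Record good g : Prop := Good {
  good_quiet : quiet g;
  good_pend : forall v, pend (g v) = None;
  good_told : forall v, told (g v) = [::];
  good_inp : forall v, inp (g v) = if v == src then Some msg else None;
  good_root : forall v, layer (g v) = 0 -> (cur (g v)).2 = inp (g v);
  good_link : forall v l, layer (g v) = l.+1 ->
    exists2 u, e v u & cur (g u) = (l, (cur (g v)).2);
  good_src : layer (g src) = 0
}.

Lemma charge0 q : charge 0 q = q. Proof. by case: q. Qed.

Lemma sampleE w g v : gstep Sample w g v =
  if (layer (g v) == 0) && (isSome (inp (g v)) || coin j (w v))
  then set_pend (Some (0, inp (g v))) (g v) else g v.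
Proof. by rewrite /global_step /lstep big1 // charge0. Qed.

Lemma selfrootE w g v : gstep SelfRoot w g v =
  if (layer (g v) == 0) && ~~ known g v
  then set_pend (Some (0, inp (g v))) (g v) else g v.
Proof. by rewrite /global_step /lstep big1 // charge0. Qed.

Lemma commitE w g v : gstep Commit w g v = commit (g v).
Proof. by rewrite /global_step /lstep big1 // charge0. Qed.

Lemma chain_quiet hs g g' : chain hs g g' -> quiet g -> quiet g'.
Proof.
elim: hs g => [|h hs IH] g /= => [->//|[g1 R c] _].
exact: IH c (relayed_quiet R).
Qed.

(** The bits of [Sample] stay explicit because the sampling coins are analysed later; those of
    [SelfRoot] and [Commit] are hidden by existentials. *)
Lemma phase_split r g : quiet g -> exists g1 g3 w2 w3,
  [/\ chain (sweeps s) (gstep Sample (fun v => take (chunk m j) (r v)) g) g1,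
      chain sweep (gstep SelfRoot w2 g1) g3 &
      execute m j e phase r g = gstep Commit w3 g3].
Proof.
move=> Q; rewrite /phase /=.
set gs := gstep Sample _ g.
rewrite run_cat /= run_cat /=.
set r1 := fun v => drop (chunk m j) (r v).
have Qs : quiet gs by move=> v; rewrite /gs sampleE; case: ifP; rewrite /= Q.
have c1 := @run_relays m j T m_gt0 n e (sweeps s) r1 gs Qs.
exists (execute m j e (relays T (sweeps s)) r1 gs).
do 3![eexists]; split; [exact: c1| |reflexivity].
by apply: run_relays => // v; rewrite selfrootE; case: ifP;
   rewrite /= (chain_quiet c1 Qs).
Qed.

Section Start.
Variables (g : 'I_n -> node) (G : good g).
Let lay v := layer (g v).

Lemma label_below v l : (l <= lay v)%N -> exists u, lay u = l.
Proof.
move: {2}(lay v - l)%N (erefl (lay v - l)%N) => k.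
elim: k v => [|k IH] v E le; first by exists v; lia.
case E2: (lay v) => [|l']; first by lia.
have [u _ cu] := good_link G E2.
have lu : lay u = l' by rewrite /lay /layer cu.
by apply: (IH u); rewrite lu; lia.
Qed.

(** Following links downwards from v meets all labels from [lay v] to 0, and n vertices have at most
    n distinct labels. Hence n layers suffice in a sweep. *)
Lemma lay_lt v : (lay v < n)%N.
Proof.
rewrite -[X in (_ < X)%N]card_ord -(size_enum_ord n) -(size_map lay) card_ord.
rewrite -[X in (X <= _)%N](size_iota 0).
apply: uniq_leq_size; first exact: iota_uniq.
move=> l; rewrite mem_iota add0n ltnS => /andP[_ /label_below[u <-]].
by apply: map_f; rewrite mem_enum.
Qed.

Lemma root_above w : exists2 b, lay b = 0 & connect (down_edge e lay) b w.
Proof.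
move E: (lay w) => k; elim: k w E => [|k IH] w E; first by exists w.
have [u ewu cu] := good_link G E.
have lu : lay u = k by rewrite /lay /layer cu.
have [b b0 cb] := IH u lu; exists b => //.
apply: connect_trans cb (connect1 _).
by rewrite /down_edge e_sym ewu E lu /=.
Qed.

(** A root above each vertex of a graph path from v to the source gives a path of clusters. It ends
    in the source itself, as no down edge enters a vertex of label 0. *)
Lemma linked_src v : lay v = 0 -> connect (linked e lay) v src.
Proof.
move=> v0.
suff H w : connect e v w ->
    exists b, [/\ connect (linked e lay) v b, lay b = 0 &
                  connect (down_edge e lay) b w].
  have [b [cb b0 /connect_last[->//|[u _ /andP[_ /eqP]]]]] := H _ (e_conn v src).
  by rewrite /lay (good_src G).
case/connectP=> p; elim/last_ind: p w => [|p x IH] w /=.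
  by move=> _ ->; exists v.
rewrite last_rcons rcons_path => /andP[pp ex] ->.
have [b [cb b0 db]] := IH _ pp erefl.
have [b' b0' db'] := root_above x.
exists b'; split=> //; apply: connect_trans cb (connect1 _).
rewrite /linked b0' /=; apply/existsP; exists (last v p); apply/existsP; exists x.
by rewrite db ex db'.
Qed.

Lemma sample_sound w : sound (gstep Sample w g).
Proof.
split=> [v|v|u w' h|v x|v l x]; rewrite ?sampleE.
- by case: ifP; rewrite /= (good_quiet G).
- by case: ifP; rewrite /= (good_told G).
- by case: ifP; rewrite /= (good_told G).
- case: ifP => /= [/andP[/eqP E _] [<-]|_]; first by [].
  by rewrite (good_pend G).
- by case: ifP => //= _; rewrite (good_pend G).
Qed.

Lemma sample_layer w v : layer (gstep Sample w g v) = lay v.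
Proof. by rewrite sampleE; case: ifP. Qed.

End Start.

Lemma selfroot_frame w g : frame g (gstep SelfRoot w g).
Proof.
split=> v; rewrite selfrootE; try by case: ifP.
by move=> ->; rewrite andbF.
Qed.

Lemma selfroot_sound w g : sound g -> sound (gstep SelfRoot w g).
Proof.
move=> S; have F := selfroot_frame w g.
have L v : layer (gstep SelfRoot w g v) = layer (g v).
  by rewrite /layer (frame_cur F).
split.
- by move=> v; rewrite selfrootE; case: ifP; rewrite /= (sound_quiet S).
- by move=> v; rewrite selfrootE; case: ifP; rewrite /= (sound_told S).
- move=> u w' h; rewrite !L => k euw fu tw; apply: frame_known F _.
  by apply: (sound_reach S _ euw fu tw); move: k; rewrite selfrootE; case: ifP.
- move=> v x; rewrite L (frame_inp F) selfrootE.
  case: ifP => [/andP[/eqP -> _] /= [<-] //|_]; exact: (sound_root S).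
- move=> v l x; rewrite selfrootE; case: ifP => // _ /(sound_link S)[u evu pu].
  by exists u => //; rewrite (frame_pend F) // /known pu.
Qed.

(** Every vertex lies below some root, so the last sweep labels it. The energy is the final credit,
    at most [3 * (T + 1) + T], plus [3 * (s + 1)] for being addressed in s+1 sweeps. *)
Lemma phase_spec r g : good g -> ok (execute m j e phase r g) ->
  let g' := execute m j e phase r g in
  [/\ good g', forall v, (spent (g' v) <= spent (g v) + (4 * T + 3 * s + 6))%N
    & forall v, layer (g' v) = 0 -> layer (g v) = 0].
Proof.
move=> G; have [g1 [g3 [w2 [w3 [c1 c3 ->]]]]] := phase_split r (good_quiet G).
set gs := global_step _ _ _ Sample _ _ in c1; set g2 := global_step _ _ _ SelfRoot _ _ in c3.
move=> O.
have O3 : ok g3 by move=> v; have := O v; rewrite commitE.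
have O2 := chain_ok c3 O3.
have O1 : ok g1 by move=> v; have := O2 v; rewrite /g2 selfrootE; case: ifP.
have Ss : sound gs by apply: sample_sound.
have S1 := chain_sound e_sym c1 O1 Ss.
have S2 : sound g2 by apply: selfroot_sound.
have S3 := chain_sound e_sym c3 O3 S2.
have F2 : frame g1 g2 by apply: selfroot_frame.
have F3 := chain_frame c3.
have F1 := chain_frame c1.
have Is v : inp (gs v) = inp (g v) by rewrite /gs sampleE; case: ifP.
have Ls v : layer (gs v) = layer (g v) by rewrite /gs sample_layer.
have L1 v : layer (g1 v) = layer (g v) by rewrite /layer (frame_cur F1) -/(layer _) Ls.
have L2 v : layer (g2 v) = layer (g v) by rewrite /layer (frame_cur F2) -/(layer _) L1.
have L3 v : layer (g3 v) = layer (g v) by rewrite /layer (frame_cur F3) -/(layer _) L2.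
have I3 v : inp (g3 v) = inp (g v) by rewrite (frame_inp F3) (frame_inp F2) (frame_inp F1).
have K v : known g3 v.
  have [b b0 cb] := root_above G v.
  apply: (sweep_below e_sym (lay_lt G) c3 O3 S2 L2 _ cb).
  by rewrite /known /g2 selfrootE L1 b0 eqxx /=; case: (boolP (known g1 b)).
have root v x : pend (g3 v) = Some (0, x) -> layer (g v) = 0 /\ x = inp (g v).
  by move/(sound_root S3); rewrite L3 I3.
split.
- split=> [v|v|v|v|v|v l|].
  + by rewrite commitE.
  + by rewrite commitE.
  + by rewrite commitE.
  + by rewrite commitE /= I3 (good_inp G).
  + rewrite commitE /layer /commit /=; have := K v; rewrite /known.
    case E: (pend (g3 v)) => [[l x]|] //= _ l0; rewrite l0 in E.
    by rewrite I3; case: (root _ _ E).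
  + rewrite commitE /layer /commit /=; have := K v; rewrite /known.
    case E: (pend (g3 v)) => [[l' x]|] //= _ lE; rewrite lE in E.
    have [u evu pu] := sound_link S3 E; exists u => //.
    by rewrite /= pu.
  + rewrite commitE /layer /commit /=.
    have -> : pend (g3 src) = Some (0, Some msg).
      have gsE : pend (gs src) = Some (0, Some msg).
        by rewrite /gs sampleE (good_src G) (good_inp G) !eqxx.
      have ks : known gs src by rewrite /known gsE.
      rewrite (frame_pend F3) ?(frame_pend F2) ?(frame_pend F1) //.
        exact: frame_known F1 ks.
      exact: frame_known F2 (frame_known F1 ks).
    by [].
- move=> v; rewrite commitE /=.
  have E1 := chain_energy v c1 O1; have E3 := chain_energy v c3 O3.
  have C1 := count_sweeps n s (layer (gs v)).
  have C3 := count_sweep n (layer (g2 v)).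
  have Es : spent (gs v) = spent (g v) by rewrite /gs sampleE; case: ifP.
  have E2 : spent (g2 v) = spent (g1 v) by rewrite /g2 selfrootE; case: ifP.
  have C2 : (credit T (g1 v) <= credit T (g2 v))%N.
    rewrite /credit /g2 selfrootE; case: ifP => //= _.
    by case: pend => /= *; lia.
  (* [told] has at most three entries, being duplicate-free with values below 3. *)
  have C4 : (credit T (g3 v) <= T.+1 * 3 + T)%N.
    rewrite /credit; apply: leq_add; last by case: pend => *; rewrite ?muln1 ?muln0.
    rewrite leq_mul2l /=; case/andP: (sound_told S3 v) => U A.
    rewrite -(size_iota 0 3); apply: uniq_leq_size => // k kt.
    by rewrite mem_iota; apply: (allP A).
  lia.
- move=> v; rewrite commitE /layer /commit /=; have := K v; rewrite /known.
  by case E: (pend (g3 v)) => [[l x]|] //= _ l0; rewrite l0 in E; case: (root _ _ E).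
Qed.

(* Q consists of the s roots after v on a simple path of clusters to the source.
   If the path is shorter it ends in the source, which is always sampled. *)
Lemma phase_root g v : good g -> layer (g v) = 0 -> v != src ->
  exists2 Q : {set 'I_n}, v \notin Q & forall r,
    ok (execute m j e phase r g) -> layer (execute m j e phase r g v) = 0 ->
    coin j (take (chunk m j) (r v)) \/
    #|Q| = s /\ {in Q, forall u, ~~ coin j (take (chunk m j) (r u))}.
Proof.
move=> G v0 nsrc; have /connectP[p0 pp0] := linked_src G v0.
(* Simplicity makes the first s roots of the path distinct, as the cardinality of Q requires, and
   keeps v out of Q. *)
case/shortenP: pp0 => p pp up _ lp.
exists [set u in take s p].
  by case/andP: up => vp _; rewrite inE; apply: contra vp; apply: mem_take.
move=> r; have [g1 [g3 [w2 [w3 [c1 c3 ->]]]]] := phase_split r (good_quiet G).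
set gs := global_step _ _ _ Sample _ _ in c1; set g2 := global_step _ _ _ SelfRoot _ _ in c3.
move=> O; rewrite commitE /layer /commit /= => l0.
have O3 : ok g3 by move=> u; have := O u; rewrite commitE.
have O2 := chain_ok c3 O3.
have O1 : ok g1 by move=> u; have := O2 u; rewrite /g2 selfrootE; case: ifP.
have Ss : sound gs by apply: sample_sound.
have [c|nc] := boolP (coin j _); [by left|right].
have pgs : pend (gs v) = None.
  rewrite /gs sampleE (negbTE nc) (good_inp G) (negbTE nsrc) /= andbF.
  exact: (good_pend G).
have Ls u : layer (gs u) = layer (g u) by rewrite /gs sample_layer.
(* An unsampled v labelled by the sweeps would have a positive label and keep it, contradicting its
   final label 0. *)
have nk : ~~ known g1 v.
  apply/negP=> k1; have S1 := chain_sound e_sym c1 O1 Ss.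
  have F2 : frame g1 g2 by apply: selfroot_frame.
  move: l0 (frame_known (chain_frame c3) (frame_known F2 k1)).
  rewrite /known; case E: (pend (g3 v)) => [[l x]|] //= l0; rewrite l0 in E.
  move: E; rewrite (frame_pend (chain_frame c3)); last exact: frame_known F2 k1.
  rewrite (frame_pend F2) // => /(chain_nonroot c1 O1).
  by rewrite pgs.
have unk u k : (k < s)%N -> (k < size p)%N -> u = nth v p k -> ~~ known gs u.
  move=> ks kp ->; apply: contra nk => ku.
  apply: (spread e_sym (lay_lt G) (p := take k.+1 p) c1 O1 Ss Ls).
  - by move: pp; rewrite -{1}(cat_take_drop k.+1 p) cat_path => /andP[].
  - by rewrite size_take; case: ifP => //; lia.
  - by rewrite (take_nth v) // last_rcons.
have sp : (s <= size p)%N.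
  rewrite leqNgt; apply/negP=> lt.
  have p_gt0 : (0 < size p)%N.
    by case: (p) lp => //= E; rewrite E eqxx in nsrc.
  have ps : ((size p).-1 < s)%N by lia.
  have pp1 : ((size p).-1 < size p)%N by rewrite prednK.
  have sE : src = nth v p (size p).-1.
    by rewrite nth_last lp; case: (p) p_gt0.
  have := unk _ _ ps pp1 sE; rewrite /known /gs sampleE.
  by rewrite (good_src G) (good_inp G) !eqxx.
split.
  rewrite cardsE; move/card_uniqP: (take_uniq s (proj2 (andP up))) => ->.
  by rewrite size_takel.
move=> u; rewrite inE => up'; have kE := nth_index v up'.
have ki : (index u (take s p) < size (take s p))%N by rewrite index_mem.
rewrite size_takel // in ki.
have := unk u _ ki (leq_trans ki sp).
rewrite -(nth_take v ki) kE => /(_ erefl).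
have u0 : layer (g u) = 0.
  move: (mem_take up') => /(nthP v)[i ip <-].
  move/(pathP v): pp => /(_ i ip) /andP[/eqP ->].
  by [].
by rewrite /known /gs sampleE u0 /=; case: coin => //; rewrite orbT.
Qed.

End Phase.

Import Order.TTheory GRing.Theory Num.Theory.

(** * Averages over the random bits *)

Section Average.
Local Open Scope ring_scope.
Variable K : realFieldType.

Definition avg (I : finType) (F : I -> K) : K := (\sum_i F i) / #|I|%:R.

Lemma le_avg (I : finType) (F G : I -> K) :
  (forall i, F i <= G i) -> avg F <= avg G.
Proof. by move=> FG; rewrite ler_wpM2r ?invr_ge0 // ler_sum. Qed.

Lemma eq_avg (I : finType) (F G : I -> K) : F =1 G -> avg F = avg G.
Proof. by move=> FG; rewrite /avg (eq_bigr G). Qed.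

Lemma avgD (I : finType) (F G : I -> K) :
  avg (fun i => F i + G i) = avg F + avg G.
Proof. by rewrite /avg big_split mulrDl. Qed.

Lemma avgB (I : finType) (F G : I -> K) :
  avg (fun i => F i - G i) = avg F - avg G.
Proof. by rewrite /avg sumrB mulrBl. Qed.

Lemma avgZ (I : finType) c (F : I -> K) : avg (fun i => c * F i) = c * avg F.
Proof. by rewrite /avg -mulr_sumr mulrA. Qed.

Lemma avg_sum (I J : finType) (F : J -> I -> K) (P : pred J) :
  avg (fun i => \sum_(k | P k) F k i) = \sum_(k | P k) avg (F k).
Proof. by rewrite /avg exchange_big /= mulr_suml. Qed.

Lemma avg_const (I : finType) c : (0 < #|I|)%N -> avg (fun _ : I => c) = c.
Proof.
by move=> I0; rewrite /avg sumr_const -(mulr_natr c) mulfK // pnatr_eq0 -lt0n.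
Qed.

Lemma card_bits_gt0 l : (0 < #|{: l.-tuple bool}|)%N.
Proof. by rewrite card_tuple card_bool expn_gt0. Qed.

Lemma card_rand_gt0 n l : (0 < #|{: {ffun 'I_n -> l.-tuple bool}}|)%N.
Proof. by rewrite card_ffun expn_gt0 card_bits_gt0. Qed.

(** Independence of the private bits of different vertices. *)
Lemma avg_prod (I B : finType) (h : I -> B -> K) :
  avg (fun w : {ffun I -> B} => \prod_i h i (w i)) = \prod_i avg (h i).
Proof.
rewrite /avg -bigA_distr_bigA big_split /=; congr (_ * _).
by rewrite card_ffun natrX prodr_const exprVn.
Qed.

Lemma sum_cat_tuple a b (F : seq bool -> K) :
  \sum_(x : (a + b).-tuple bool) F x =
  \sum_(y : a.-tuple bool) \sum_(z : b.-tuple bool) F (y ++ z).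
Proof.
rewrite pair_big /=.
rewrite (reindex (fun yz : a.-tuple bool * b.-tuple bool => cat_tuple yz.1 yz.2)) //=.
have tP (x : (a + b).-tuple bool) : size (take a x) == a.
  by rewrite size_takel // size_tuple leq_addr.
have dP (x : (a + b).-tuple bool) : size (drop a x) == b.
  by rewrite size_drop size_tuple addKn.
apply: onW_bij; exists (fun x => (Tuple (tP x), Tuple (dP x))).
  move=> [y z]; congr (_, _); apply: val_inj => /=.
    by rewrite take_size_cat // size_tuple.
  by rewrite drop_size_cat // size_tuple.
by move=> x; apply: val_inj => /=; rewrite cat_take_drop.
Qed.

Lemma sum_cat_rand n a b (F : ('I_n -> seq bool) -> K) :
  \sum_(x : {ffun 'I_n -> (a + b).-tuple bool}) F (fun v => x v) =
  \sum_(y : {ffun 'I_n -> a.-tuple bool})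
    \sum_(z : {ffun 'I_n -> b.-tuple bool}) F (fun v => y v ++ z v).
Proof.
rewrite pair_big /=.
rewrite (reindex (fun yz : {ffun 'I_n -> a.-tuple bool} * {ffun 'I_n -> b.-tuple bool} =>
   [ffun v => cat_tuple (yz.1 v) (yz.2 v)])) /=.
  apply: eq_bigr => yz _; congr F; apply: functional_extensionality => v.
  by rewrite ffunE.
have tP (x : (a + b).-tuple bool) : size (take a x) == a.
  by rewrite size_takel // size_tuple leq_addr.
have dP (x : (a + b).-tuple bool) : size (drop a x) == b.
  by rewrite size_drop size_tuple addKn.
apply: onW_bij.
exists (fun x : {ffun 'I_n -> (a + b).-tuple bool} =>
  ([ffun v => Tuple (tP (x v))], [ffun v => Tuple (dP (x v))])).
  move=> [y z]; congr (_, _); apply/ffunP=> v; apply: val_inj; rewrite !ffunE /=.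
    by rewrite take_size_cat // size_tuple.
  by rewrite drop_size_cat // size_tuple.
by move=> x; apply/ffunP=> v; apply: val_inj; rewrite !ffunE /= cat_take_drop.
Qed.

Lemma avg_prefix k l (s : seq bool) : size s = k -> (k <= l)%N ->
  avg (fun b : l.-tuple bool => (take k b == s)%:R) = 2^-1 ^+ k.
Proof.
move=> sk kl; rewrite -(subnKC kl); move: (l - k)%N => r {l kl}.
rewrite /avg (sum_cat_tuple k r (fun b => (take k b == s)%:R)).
pose s' : k.-tuple bool := tcast sk (in_tuple s).
have s'E : tval s' = s by rewrite val_tcast.
rewrite (bigD1 s') //= [X in _ + X]big1 ?addr0; last first.
  move=> y ys; rewrite big1 // => z _; rewrite take_size_cat ?size_tuple //.
  case: eqP => // ys'; case/eqP: ys; apply: val_inj.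
  exact: etrans ys' (esym s'E).
rewrite (eq_bigr (fun _ => 1)); last first.
  by move=> z _; rewrite take_size_cat ?size_tuple // s'E eqxx.
rewrite sumr_const !card_tuple card_bool expnD !natrM !natrX invfM mulrCA.
by rewrite mulfV ?mulr1 ?exprVn // expf_neq0 // pnatr_eq0.
Qed.

(** The event says that b begins with i-1 ones followed by a zero, so it fixes a prefix of length
    i. *)
Lemma avg_level i l : (0 < i <= l)%N ->
  avg (fun b : l.-tuple bool => (level b == i)%:R) = 2^-1 ^+ i.
Proof.
case: i => // i il.
rewrite -(@avg_prefix i.+1 l (rcons (nseq i true) false)) ?size_rcons ?size_nseq //.
apply: eq_avg => b; congr (_%:R : K); congr nat_of_bool.
rewrite /level eqSS.
have : (i < size b)%N by rewrite size_tuple.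
elim: i (tval b) {il} => [|i IH] [|[] s] //= si; first by rewrite take0.
by rewrite eqSS IH.
Qed.

Lemma avg_coin j l : (j <= l)%N ->
  avg (fun b : l.-tuple bool => (coin j b)%:R) = 2^-1 ^+ j.
Proof.
move=> jl; rewrite -(@avg_prefix j l (nseq j true)) ?size_nseq //.
apply: eq_avg => b; congr (_%:R : K); congr nat_of_bool; rewrite /coin.
have : (j <= size b)%N by rewrite size_tuple.
by elim: j (tval b) {jl} => [|j IH] [|[] s] //= /IH.
Qed.

End Average.

(** * Expected values over a sequence of steps *)

Section Expect.
Local Open Scope ring_scope.
Variable K : realFieldType.
Variables (m j n : nat) (e : rel 'I_n).
Implicit Types (g : 'I_n -> node) (p : seq step) (F G : ('I_n -> node) -> K).

Local Notation run := (execute m j e).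
Local Notation gstep := (global_step m j e).
Local Notation rand := {ffun 'I_n -> (chunk m j).-tuple bool}.

(** Averages over the fresh bits of one step at a time, so that a bound for the remaining steps
    applies at every intermediate configuration. *)
Fixpoint expect p F g : K :=
  if p is st :: p' then
    avg (fun w : rand => expect p' F (gstep st (fun v => w v) g))
  else F g.

Lemma expect_cat p1 p2 F g :
  expect (p1 ++ p2) F g = expect p1 (expect p2 F) g.
Proof.
by elim: p1 g => //= st p1 IH g; apply: eq_avg => w; rewrite IH.
Qed.

Lemma run_cons_cat st p (w r : 'I_n -> seq bool) g :
  (forall v, size (w v) = chunk m j) ->
  run (st :: p) (fun v => w v ++ r v) g = run p r (gstep st w g).
Proof.
move=> sw /=; congr execute.
  by apply: functional_extensionality => v; rewrite drop_size_cat.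
congr global_step.
by apply: functional_extensionality => v; rewrite take_size_cat.
Qed.

Lemma le_expect p F G g : (forall r, F (run p r g) <= G (run p r g)) ->
  expect p F g <= expect p G g.
Proof.
elim: p g => [|st p IH] g FG; first exact: (FG (fun _ => [::])).
apply: le_avg => w; apply: IH => r.
by have := FG (fun v => w v ++ r v); rewrite run_cons_cat // => v; rewrite size_tuple.
Qed.

Lemma expect_const p c g : expect p (fun _ => c) g = c.
Proof.
elim: p g => //= st p IH g; rewrite (eq_avg (G := fun _ => c)) //.
by rewrite avg_const // card_rand_gt0.
Qed.

Lemma expectD p F G g :
  expect p (fun g => F g + G g) g = expect p F g + expect p G g.
Proof.
by elim: p g => //= st p IH g; rewrite -avgD; apply: eq_avg => w; rewrite IH.
Qed.

Lemma expectZ p c F g : expect p (fun g => c * F g) g = c * expect p F g.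
Proof.
by elim: p g => //= st p IH g; rewrite -avgZ; apply: eq_avg => w; rewrite IH.
Qed.

Lemma expect_sum (I : finType) (P : pred I) p (F : I -> ('I_n -> node) -> K) g :
  expect p (fun g => \sum_(i | P i) F i g) g = \sum_(i | P i) expect p (F i) g.
Proof.
by elim: p g => //= st p IH g; rewrite -avg_sum; apply: eq_avg => w; rewrite IH.
Qed.

Lemma expect_le p F g c : (forall r, F (run p r g) <= c) -> expect p F g <= c.
Proof. by move=> Fc; rewrite -[leRHS](expect_const p c g); apply: le_expect. Qed.

(** A uniform string for [st :: p] is a uniform chunk followed by a uniform string for p. This turns
    expectations into the counts of bit assignments used by [whp_success]. *)
Lemma expect_sum_rand p F g :
  \sum_(f : {ffun 'I_n -> (size p * chunk m j).-tuple bool}) F (run p (fun v => f v) g)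
  = expect p F g * #|{: {ffun 'I_n -> (size p * chunk m j).-tuple bool}}|%:R.
Proof.
elim: p g => [|st p IH] g /=.
  by rewrite sumr_const -(mulr_natr (F g)).
rewrite (@sum_cat_rand K n (chunk m j) (size p * chunk m j)
  (fun r => F (run (st :: p) r g))).
pose N l : K := #|{: {ffun 'I_n -> l.-tuple bool}}|%:R.
have NE a b : N (a + b)%N = N a * N b.
  by rewrite /N -natrM !card_ffun !card_tuple expnD expnMn.
rewrite (eq_bigr (fun w : rand => expect p F (gstep st (fun v => w v) g) *
    N (size p * chunk m j)%N)); last first.
  move=> w _; rewrite -IH; apply: eq_bigr => z _; congr F.
  by apply: run_cons_cat => v; rewrite size_tuple.
rewrite -/(N _) -[((size p).+1 * _)%N]/(chunk m j + size p * chunk m j)%N NE.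
rewrite -mulr_suml /avg mulrA divfK //.
by rewrite pnatr_eq0 -lt0n card_rand_gt0.
Qed.

End Expect.

(** * The walk of a listener *)

Section WalkNumerics.
Local Open Scope ring_scope.
Variable K : realFieldType.
Implicit Types (q : K) (k i c : nat).

(** Bounds the probability of silence, when k senders transmit with probability q each, by
    [1 / (1 + k q)]. The induction rests on [(1 - q) (1 + (k+1) q) <= 1 + k q]. *)
Lemma none_bound q k : 0 <= q <= 1 -> (1 - q) ^+ k * (1 + k%:R * q) <= 1.
Proof.
move=> /andP[q0 q1]; elim: k => [|k IH]; first by rewrite mul0r addr0 mulr1.
apply: le_trans IH; rewrite exprS mulrAC [leLHS]mulrC ler_wpM2l ?exprn_ge0 ?subr_ge0 //.
have : 0 <= k.+1%:R :> K by []. have : 0 <= k%:R :> K by [].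
rewrite -natr1; set x := k%:R => x0 x1; nra.
Qed.

(** The left side is the probability of noise, at most the expected number of transmitting pairs. *)
Lemma several_bound q k : 0 <= q <= 1 ->
  1 - (1 - q) ^+ k - k%:R * q * (1 - q) ^+ k.-1 <= (k%:R * q) ^+ 2 / 2.
Proof.
move=> /andP[q0 q1]; case: k => [|k]; first by rewrite !expr0 expr2; lra.
(* With k+1 senders this is the exact number of pairs times [q ^+ 2], the form that passes through
   the induction. *)
suff H : 1 - (1 - q) ^+ k * (1 + k%:R * q) <= q ^+ 2 * (k%:R * (k%:R + 1)) / 2.
  have k0 : 0 <= k%:R :> K by [].
  rewrite /= exprS -natr1; move: k0 H; set x := k%:R; set a := _ ^+ k => k0 H.
  have -> : 1 - (1 - q) * a - (x + 1) * q * a = 1 - a * (1 + x * q) by ring.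
  apply: le_trans H _; rewrite ler_wpM2r ?invr_ge0 ?ler0n //.
  rewrite exprMn mulrC ler_wpM2r ?exprn_ge0 //; nra.
elim: k => [|k IH]; first by rewrite expr0 !mul0r addr0 mulr1 subrr mulr0 mul0r.
rewrite exprS -natr1; have k0 : 0 <= k%:R :> K by [].
have a1 : (1 - q) ^+ k <= 1 by rewrite exprn_ile1 ?subr_ge0 // gerBl.
move: k0 IH a1; set x := k%:R; set a := _ ^+ k => k0 IH a1.
have -> : 1 - (1 - q) * a * (1 + (x + 1) * q) =
  (1 - a * (1 + x * q)) + a * ((x + 1) * q ^+ 2) by ring.
have : a * ((x + 1) * q ^+ 2) <= 1 * ((x + 1) * q ^+ 2).
  by rewrite ler_wpM2r // mulr_ge0 ?exprn_ge0 // addr_ge0.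
rewrite mul1r; move: IH; set A := 1 - _; set B := a * _ => IH Ble.
have -> : q ^+ 2 * ((x + 1) * (x + 1 + 1)) / 2 =
  q ^+ 2 * (x * (x + 1)) / 2 + (x + 1) * q ^+ 2 by field.
exact: lerD.
Qed.

(** The right side equals 1/4 at i = 1 and increases with i, since [(1 - q / 2)^2 >= 1 - q]. *)
Lemma quarter_bound i : (0 < i)%N -> 4^-1 <= (1 - 2^-1 ^+ i) ^+ (2 ^ i) :> K.
Proof.
case: i => // i _; elim: i => [|i IH]; first by rewrite expr1 expn1; lra.
apply: le_trans IH _; rewrite [in leRHS]expnS exprM.
have q0 : 0 <= 2^-1 ^+ i.+1 :> K by apply: exprn_ge0; lra.
have q1 : 2^-1 ^+ i.+1 <= 1 :> K by apply: exprn_ile1; lra.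
rewrite [2^-1 ^+ i.+2]exprS.
move: q0 q1; set q := 2^-1 ^+ i.+1 => q0 q1.
apply: lerXn2r; rewrite ?nnegrE; first by rewrite subr_ge0.
  by rewrite exprn_ge0 // subr_ge0; lra.
by rewrite expr2; nra.
Qed.

(* The base of the potential and its decay rate; they satisfy
   2/5 mu + 3/5 / mu <= lam below the centre of the walk,
   9/32 mu + 23/32 / mu <= lam above it and 61/64 mu <= lam at the centre. *)
Definition mu : K := 31 / 30.
Definition lam : K := 199 / 200.

(** By Bernoulli, [(1 + d)^N >= 1 + N d >= 2], hence [x^N <= 1/2]. *)
Lemma pow_half (x d : K) N A : 0 <= x -> 0 <= d -> x * (1 + d) = 1 ->
  1 <= N%:R * d -> x ^+ (N * A) <= 2^-1 ^+ A.
Proof.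
move=> x0 d0 xd Nd; rewrite exprM; apply: lerXn2r; rewrite ?nnegrE ?exprn_ge0 ?invr_ge0 //.
have B k : 1 + k%:R * d <= (1 + d) ^+ k.
  elim: k => [|k IH]; first by rewrite mul0r addr0 expr0.
  rewrite exprS -natr1; have : 0 <= k%:R :> K by [].
  move: IH; set z := k%:R; set y := _ ^+ k => IH z0; nra.
have E : x ^+ N * (1 + d) ^+ N = 1 by rewrite -exprMn xd expr1n.
have := B N; have : 0 <= x ^+ N by rewrite exprn_ge0.
move: E; set a := x ^+ _; set y := _ ^+ N => E a0 By.
have y2 : 2 <= y by apply: le_trans By; lra.
nra.
Qed.

(** Source of the factor 200 in the number of probes. *)
Lemma lam_half A : lam ^+ (200 * A) <= 2^-1 ^+ A.
Proof. by apply: (@pow_half _ (1 / 199)); rewrite /lam; lra. Qed.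

Definition dist i c := ((i - c) + (c - i))%N.

Lemma dist_down_le i c : (0 < c)%N -> (dist (maxn 1 i.-1) c <= (dist i c).+1)%N.
Proof. rewrite /dist; lia. Qed.

Lemma dist_up_le m i c : (c <= m)%N -> (dist (minn m i.+1) c <= (dist i c).+1)%N.
Proof. rewrite /dist; lia. Qed.

Lemma dist_down_lt i c : (0 < c < i)%N -> dist i c = (dist (maxn 1 i.-1) c).+1.
Proof. rewrite /dist; lia. Qed.

Lemma dist_up_lt m i c : (i < c <= m)%N -> dist i c = (dist (minn m i.+1) c).+1.
Proof. rewrite /dist; lia. Qed.

Lemma few_silent (p x : K) : 0 <= p -> p * (1 + x) <= 1 -> 3 <= 2 * x ->
  p <= 2 / 5.
Proof. by move=> *; nra. Qed.

Lemma few_noisy (p x : K) : 0 <= x -> p <= x ^+ 2 / 2 -> 4 * x <= 3 ->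
  p <= 9 / 32.
Proof. by move=> x0 px x3; apply: le_trans px _; rewrite expr2; nra. Qed.

Lemma many_alone (x y : K) : 3 <= 4 * x -> 1 / 16 <= y -> 3 / 64 <= x * y.
Proof. by move=> *; nra. Qed.

Lemma sixteenth (x : K) : 4^-1 <= x -> 1 / 16 <= x ^+ 2.
Proof. by move=> *; rewrite expr2; nra. Qed.

(** Here M is the potential after the move towards the centre, [mu * M] the current one, and U the
    one after the wrong move, which silence causes. Reception contributes 0. In [drift_high] silence
    and noise exchange roles. *)
Lemma drift_low (p0 p2 M U : K) : 0 <= p0 -> p0 <= 2 / 5 -> p2 <= 1 - p0 ->
  0 < M -> U <= mu * (mu * M) -> p0 * U + p2 * M <= lam * (mu * M).
Proof.
move=> p00 p025 p2l M0 UM; apply: (@le_trans _ _ (p0 * (mu * (mu * M)) + p2 * M)).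
  by rewrite lerD2r ler_wpM2l.
have -> : p0 * (mu * (mu * M)) + p2 * M = M * (p0 * mu ^+ 2 + p2) by ring.
have -> : lam * (mu * M) = M * (lam * mu) by ring.
by rewrite ler_pM2l // /mu /lam; lra.
Qed.

Lemma drift_high (p0 p2 M U : K) : 0 <= p2 -> p2 <= 9 / 32 -> p2 <= 1 - p0 ->
  0 < M -> U <= mu * (mu * M) -> p0 * M + p2 * U <= lam * (mu * M).
Proof.
move=> p00 p025 p2l M0 UM; apply: (@le_trans _ _ (p0 * M + p2 * (mu * (mu * M)))).
  by rewrite lerD2l ler_wpM2l.
have -> : p0 * M + p2 * (mu * (mu * M)) = M * (p0 + p2 * mu ^+ 2) by ring.
have -> : lam * (mu * M) = M * (lam * mu) by ring.
by rewrite ler_pM2l // /mu /lam; lra.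
Qed.

Lemma drift_center (p0 p1 U V : K) : 0 <= p0 -> 0 <= 1 - p0 - p1 ->
  3 / 64 <= p1 -> U <= mu -> V <= mu -> p0 * U + (1 - p0 - p1) * V <= lam.
Proof.
move=> p00 p20 p1l Umu Vmu.
apply: (@le_trans _ _ (p0 * mu + (1 - p0 - p1) * mu)).
  by apply: lerD; rewrite ler_wpM2l.
by rewrite /mu /lam; lra.
Qed.

Lemma several_ge0 q k : 0 <= q <= 1 ->
  0 <= 1 - (1 - q) ^+ k - k%:R * q * (1 - q) ^+ k.-1.
Proof.
move=> q01; case: k => [|k]; first by rewrite !expr0; lra.
have := none_bound k q01; rewrite /= exprS -natr1.
by set x := k%:R; set y := _ ^+ k => H; nra.
Qed.

(* The centre c of the walk is the level with 3/4 <= k 2^-c < 3/2. *)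
Lemma walk_step m k c i (q := 2^-1 ^+ i : K) (p0 := (1 - q) ^+ k)
  (p1 := k%:R * q * (1 - q) ^+ k.-1) : (2 * k < 3 * 2 ^ c)%N -> (3 * 2 ^ c <= 4 * k)%N ->
  (0 < c <= m)%N -> (0 < i <= m)%N ->
  p0 * mu ^+ dist (maxn 1 i.-1) c + (1 - p0 - p1) * mu ^+ dist (minn m i.+1) c
    <= lam * mu ^+ dist i c.
Proof.
move=> kc ck /andP[c0 cm] /andP[i0 im].
have q0 : 0 < q by apply: exprn_gt0; lra.
have q1 : q <= 1 by apply: exprn_ile1; lra.
have q01 : 0 <= q <= 1 by rewrite ltW.
have q2 : q * 2 ^+ i = 1 by rewrite -exprMn mulVf ?expr1n ?pnatr_eq0.
have p0_ge0 : 0 <= p0 by rewrite exprn_ge0 // subr_ge0.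
have kq0 : 0 <= k%:R * q by rewrite mulr_ge0 // ltW.
have p1_ge0 : 0 <= p1 by rewrite mulr_ge0 ?exprn_ge0 ?subr_ge0.
have p2_le := several_bound k q01.
have p2_ge0 := several_ge0 k q01.
have p2_le1 : 1 - p0 - p1 <= 1 - p0 by rewrite gerDl oppr_le0.
have mu1 : 1 <= mu by rewrite /mu; lra.
have mu0 d : 0 < mu ^+ d by rewrite exprn_gt0 // (lt_le_trans _ mu1).
have up d d' : (d <= d')%N -> mu ^+ d <= mu ^+ d' by move=> dd; rewrite ler_weXn2l.
(* Since [q * 2 ^ i = 1], comparisons of k with [2 ^ i] become comparisons of the expected number
   [k q] of transmitters with a constant. *)
have lo a b : (a * 2 ^ i <= b * k)%N -> a%:R <= b%:R * (k%:R * q).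
  rewrite -(ler_nat K) !natrM natrX => /(ler_wpM2r (ltW q0)).
  by rewrite -!mulrA [2%:R ^+ i * q]mulrC q2 mulr1.
have hi a b : (b * k <= a * 2 ^ i)%N -> b%:R * (k%:R * q) <= a%:R.
  rewrite -(ler_nat K) !natrM natrX => /(ler_wpM2r (ltW q0)).
  by rewrite -!mulrA [2%:R ^+ i * q]mulrC q2 mulr1.
have [ic|ci|ic] := ltngtP i c.
(* Below the centre [k q >= 3/2], so silence has probability at most 2/5. *)
- have h : 3%:R <= 2%:R * (k%:R * q).
    apply: lo; clear -ic ck; have : (2 ^ i.+1 <= 2 ^ c)%N by rewrite leq_exp2l.
    by rewrite expnS; lia.
  have du : dist i c = _ := @dist_up_lt m i c (introT andP (conj ic cm)).
  have := up _ _ (dist_down_le i c0); rewrite du !exprS => u.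
  exact: drift_low p0_ge0 (few_silent p0_ge0 (none_bound k q01) h) p2_le1 (mu0 _) u.
(* Above the centre [k q <= 3/4], so noise has probability at most 9/32. *)
- have h : 4%:R * (k%:R * q) <= 3%:R.
    apply: hi; clear -ci kc; have : (2 ^ c.+1 <= 2 ^ i)%N by rewrite leq_exp2l.
    by rewrite expnS; lia.
  have du : dist i c = _ := @dist_down_lt i c (introT andP (conj c0 ci)).
  have := up _ _ (dist_up_le i cm); rewrite du !exprS => u.
  exact: drift_high p2_ge0 (few_noisy kq0 p2_le h) p2_le1 (mu0 _) u.
(* At the centre [k q >= 3/4] and [k - 1 <= 2 * 2 ^ i], so exactly one sender transmits with
   probability at least [3/4 * 1/16]. *)
- have h : 3%:R <= 4%:R * (k%:R * q) by apply: lo; rewrite ic.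
  have d0 : dist i c = 0 by rewrite /dist ic subnn.
  have := up _ _ (dist_down_le i c0); have := up _ _ (dist_up_le i cm).
  rewrite d0 expr1 expr0 mulr1 => u2 u1.
  apply: drift_center => //; apply: many_alone h _.
  apply: (@le_trans _ _ ((1 - q) ^+ (2 ^ i * 2))).
    by rewrite exprM; apply: sixteenth; apply: quarter_bound.
  apply: ler_wiXn2l; rewrite ?subr_ge0 // ?gerBl ?(ltW q0) //.
  by clear -ic kc; rewrite ic; lia.
Qed.

End WalkNumerics.

(** * Drift of the walk under random levels *)

Section ProbeAverage.
Variables (m j n : nat) (e : rel 'I_n).
Implicit Types (g : 'I_n -> node).
Local Open Scope ring_scope.
Variable K : realFieldType.

Local Notation gstep := (global_step m j e).
Local Notation rand := {ffun 'I_n -> (chunk m j).-tuple bool}.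
Local Notation expect := (expect m j e).

Definition is_sending q := if duty q is Sending then true else false.
Definition is_walking q := if duty q is Walk _ then true else false.

Definition sending g v := [set u | e v u & is_sending (g u)].

Lemma probe_sending w g v : sending (gstep Probe w g) v = sending g v.
Proof.
apply/setP=> u; rewrite !inE; congr (_ && _).
rewrite /global_step /lstep; move: (mkseq _ _) => fs.
rewrite /is_sending /charge /=; case E: (duty (g u)) => [||i]; rewrite ?E //.
by case: nth => /=; rewrite ?E.
Qed.

Lemma probe_walking w g v : is_walking (gstep Probe w g v) -> is_walking (g v).
Proof.
rewrite /global_step /lstep; move: (mkseq _ _) => fs.
by rewrite /is_walking /charge /=; case E: (duty (g v)) => [||i]; rewrite ?E.
Qed.

Definition heard g v i (w : 'I_n -> seq bool) :=
  [set u in sending g v | level (w u) == i].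

Lemma probe_duty w g v i : duty (g v) = Walk i -> (0 < i <= m)%N ->
  duty (gstep Probe w g v) =
  if #|heard g v i w| == 0%N then Walk (maxn 1 i.-1)
  else if #|heard g v i w| == 1%N then Off else Walk (minn m i.+1).
Proof.
move=> Dv im; rewrite /global_step /lstep; move Efs: (mkseq _ _) => fs.
rewrite /charge /= Dv -Efs nth_mkseq; last by rewrite /width; lia.
rewrite /gfeed; set A := fun u => _.
have Av : A v = Listen by rewrite /A /= Dv eqxx.
have SE : [set u | e v u & isSome (sent (A u))] = heard g v i w.
  apply/setP=> u; rewrite !inE /A /is_sending /=.
  by case: (duty (g u)) => [||i'] /=; rewrite ?andbF // eq_sym ?andbT;
    case: (_ == _); rewrite ?andbF ?andbT.
have := feedbackP e Av; rewrite SE.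
case=> [->|u p ->|S1] /=; rewrite ?cards0 ?cards1 //.
by case: #|heard g v i w| S1 => [|[]].
Qed.

Lemma prod_bool (I : finType) (f : I -> bool) :
  \prod_i ((f i)%:R : K) = [forall i, f i]%:R.
Proof.
case: forallP => [H|/forallP/forallPn[i ni]].
  by rewrite big1 // => i _; rewrite H.
by rewrite (bigD1 i) //= (negbTE ni) mul0r.
Qed.

(** The event is a conjunction of conditions on the bits of single vertices, so its probability
    factorises: members of Y contribute [2^-i], other senders [1 - 2^-i], all remaining vertices
    1. *)
Lemma avg_heard g v i (Y : {set 'I_n}) : (0 < i <= m)%N -> Y \subset sending g v ->
  avg (fun w : rand => (heard g v i (fun u => w u) == Y)%:R : K) =
  (2^-1 ^+ i) ^+ #|Y| * (1 - 2^-1 ^+ i) ^+ #|sending g v :\: Y|.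
Proof.
move=> im YS.
pose h (u : 'I_n) (b : (chunk m j).-tuple bool) : K :=
  ((u \in sending g v) ==> ((level b == i) == (u \in Y)))%:R.
have -> : avg (fun w : rand => (heard g v i (fun u => w u) == Y)%:R : K) =
          avg (fun w : rand => \prod_u h u (w u)).
  apply: eq_avg => w; rewrite prod_bool; congr (nat_of_bool _)%:R.
  apply/eqP/forallP => [<- u|H].
    by rewrite [u \in heard _ _ _ _]inE; case: (u \in sending _ _) => /=.
  apply/setP=> u; rewrite [u \in heard _ _ _ _]inE; have := H u.
  case: (boolP (u \in sending g v)) => /= [_ /eqP //|nS _].
  by apply/esym/negbTE; apply: contra nS; apply: (subsetP YS).
rewrite avg_prod.
have L : (i <= chunk m j)%N by rewrite /chunk; lia.
have avq : avg (fun b : (chunk m j).-tuple bool => (level b == i)%:R : K) = 2^-1 ^+ i.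
  by apply: avg_level; lia.
rewrite (eq_bigr (fun u => if u \in Y then 2^-1 ^+ i else
   if u \in sending g v :\: Y then 1 - 2^-1 ^+ i else 1)); last first.
  move=> u _; rewrite /h in_setD; case: (boolP (u \in Y)) => uY /=.
    rewrite (subsetP YS _ uY) -avq; apply: eq_avg => b.
    by case: (_ == i).
  case: (u \in sending g v) => /=; last by rewrite avg_const // card_bits_gt0.
  rewrite -avq -[X in X - _](@avg_const K ((chunk m j).-tuple bool)) ?card_bits_gt0 //.
  rewrite -avgB; apply: eq_avg => b; case: (_ == i) => /=; by rewrite ?subrr ?subr0.
rewrite (bigID (mem Y)) /= (eq_bigr (fun _ => 2^-1 ^+ i)); last by move=> u ->.
rewrite prodr_const; congr (_ * _).
rewrite (eq_bigr (fun u => if u \in sending g v :\: Y then 1 - 2^-1 ^+ i else 1));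
  last by move=> u /negbTE ->.
rewrite -big_mkcondr /= (eq_bigl (mem (sending g v :\: Y))) ?prodr_const //.
by move=> u; rewrite /= in_setD; case: (u \in Y).
Qed.

(** It vanishes once the walk has ended and is at least 1 before, so its mean bounds the probability
    that the walk is still running. *)
Definition potential c v g : K :=
  if duty (g v) is Walk i then mu K ^+ dist i c else 0.

Lemma potential_step k c g v : (2 * k < 3 * 2 ^ c)%N -> (3 * 2 ^ c <= 4 * k)%N ->
  (0 < c <= m)%N -> (forall i, duty (g v) = Walk i -> (0 < i <= m)%N) ->
  (is_walking (g v) -> #|sending g v| = k) ->
  avg (fun w : rand => potential c v (gstep Probe (fun u => w u) g))
    <= lam K * potential c v g.
Proof.
move=> kc ck cm im kE.
have [wk|nwk] := boolP (is_walking (g v)); last first.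
  rewrite (eq_avg (G := fun _ => 0)); last first.
    move=> w; rewrite /potential.
    have := contra (@probe_walking (fun u => w u) g v) nwk.
    by rewrite /is_walking; case: duty.
  rewrite avg_const ?card_rand_gt0 //; rewrite /potential.
  by move: nwk; rewrite /is_walking; case: duty; rewrite ?mulr0.
move: (kE wk) => {}kE.
move: wk; rewrite /is_walking; case E: (duty (g v)) => [||i] // _.
have {}im := im _ E; rewrite /potential E.
set q := 2^-1 ^+ i : K.
(* a and b are the indicators of silence and of reception; b is split by the transmitting sender so
   that [avg_heard] applies. *)
pose a (w : rand) : K := (heard g v i (fun u => w u) == set0)%:R.
pose b (w : rand) : K :=
  \sum_(u in sending g v) (heard g v i (fun u => w u) == [set u])%:R.
have bE w : b w = (#|heard g v i (fun u => w u)| == 1%N)%:R.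
  rewrite /b; case: cards1P => [[x hx]|N].
    have xS : x \in sending g v.
      have : x \in heard g v i (fun u => w u) by rewrite hx set11.
      by rewrite [x \in heard _ _ _ _]inE => /andP[].
    rewrite (bigD1 x) //= hx eqxx big1 ?addr0 // => u /andP[_ ux].
    by rewrite (inj_eq set1_inj) eq_sym (negbTE ux).
  rewrite big1 // => u _; case: eqP => // H; case: N; by exists u.
have aE : avg a = (1 - q) ^+ k.
  by rewrite avg_heard ?sub0set // cards0 expr0 mul1r setD0 kE.
have bA : avg b = k%:R * q * (1 - q) ^+ k.-1.
  rewrite avg_sum (eq_bigr (fun _ => q * (1 - q) ^+ k.-1)).
    by rewrite sumr_const kE -mulrA mulr_natl.
  move=> u uS; rewrite avg_heard ?sub1set // cards1 expr1.
  by rewrite (cardsD1 u) uS in kE; rewrite -kE.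
rewrite (eq_avg (G := fun w => mu K ^+ dist (maxn 1 i.-1) c * a w +
   mu K ^+ dist (minn m i.+1) c * (1 - a w - b w))); last first.
  move=> w; rewrite (probe_duty _ E im) bE /a -cards_eq0.
  by case: #|heard g v i _| => [|[|x]] /=; ring.
rewrite avgD !avgZ !avgB avg_const ?card_rand_gt0 // aE bA.
by rewrite mulrC [X in _ + X]mulrC; apply: walk_step.
Qed.

Lemma potential_bound t k c g v : (2 * k < 3 * 2 ^ c)%N ->
  (3 * 2 ^ c <= 4 * k)%N ->
  (0 < c <= m)%N -> (forall i, duty (g v) = Walk i -> (0 < i <= m)%N) ->
  (is_walking (g v) -> #|sending g v| = k) ->
  expect (nseq t Probe) (potential c v) g <= lam K ^+ t * potential c v g.
Proof.
move=> kc ck cm; elim: t g => [|t IH] g im kE; first by rewrite expr0 mul1r.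
rewrite exprSr -mulrA /=.
apply: le_trans (_ : lam K ^+ t * avg (fun w : rand =>
   potential c v (gstep Probe (fun u => w u) g)) <= _); last first.
  have lam0 : 0 <= lam K by rewrite /lam; lra.
  rewrite ler_wpM2l ?exprn_ge0 //.
  exact: potential_step kc ck cm im kE.
rewrite -avgZ; apply: le_avg => w; apply: IH; last first.
  by move=> /probe_walking/kE; rewrite probe_sending.
move=> i' E'.
have : is_walking (gstep Probe (fun u => w u) g v) by rewrite /is_walking E'.
move/probe_walking; rewrite /is_walking; case E: (duty (g v)) => [||i] // _.
move: E'; rewrite (probe_duty _ E (im _ E)); have := im _ E.
by case: ifP => _; [|case: ifP => _ //] => H [<-]; lia.
Qed.

(** The centre is the least c with [2 k < 3 * 2 ^ c]; minimality gives the second inequality, and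
    [k > 1] excludes c = 0. *)
Lemma walk_center k : (1 < k)%N -> (2 * k < 3 * 2 ^ m)%N ->
  exists2 c, (0 < c <= m)%N & ((2 * k < 3 * 2 ^ c) && (3 * 2 ^ c <= 4 * k))%N.
Proof.
move=> k1 km.
have ex : exists c, (2 * k < 3 * 2 ^ c)%N by exists m.
case: (ex_minnP ex) => c kc cmin; exists c.
  rewrite (cmin _ km) andbT lt0n; apply/eqP=> c0; rewrite c0 expn0 in kc; lia.
rewrite kc /=; case: c kc cmin => [|c] kc cmin; first by rewrite expn0; lia.
have : ~~ (2 * k < 3 * 2 ^ c)%N.
  by apply/negP=> /cmin; rewrite ltnn.
by rewrite expnS; lia.
Qed.

End ProbeAverage.

(** * Success probability *)

Section Failure.
Variables (m j a n : nat) (e : rel 'I_n) (m_gt0 : (0 < m)%N).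
Variable K : realFieldType.
Implicit Types (g : 'I_n -> node).
Local Open Scope ring_scope.

Local Notation gstep := (global_step m j e).
Local Notation run := (execute m j e).
Local Notation rand := {ffun 'I_n -> (chunk m j).-tuple bool}.
Local Notation expect := (expect m j e).
Let T := (200 * (m + a))%N.
Hypothesis deg : forall v, (2 * #|[set u | e v u]| < 3 * 2 ^ m)%N.

Lemma fail_step st w g v : fail (g v) -> fail (gstep st w g v).
Proof.
rewrite /global_step /lstep; move: (mkseq _ _) => fs f.
case: st => [|||h||] //=; try by case: ifP.
- by case: ifP => // _; case: ifP => // _; case: nth.
- by case: duty => // i; case: nth.
- by rewrite f.
Qed.

Lemma run_fail p r g v : fail (g v) -> fail (run p r g v).
Proof. by elim: p r g => //= st p IH r g f; apply/IH/fail_step. Qed.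

Lemma run_probes t r g v : 
  fail (run (nseq t Probe) r g v) = fail (g v) /\
  (is_walking (run (nseq t Probe) r g v) -> is_walking (g v)).
Proof.
elim: t r g => [|t IH] r g //=.
have [-> H] := IH (fun v => drop (chunk m j) (r v)) (gstep Probe (fun v => take (chunk m j) (r v)) g).
split; last by move=> /H/probe_walking.
rewrite /global_step /lstep /=; case: duty => // i; by case: nth.
Qed.

(** The initial potential is at most [mu^m <= 2^m], and T probes multiply its mean by at most
    [lam^T <= 2^-(m+a)]. *)
Lemma walk_prob h g t g1 v : (forall u, midway m e h g t u (g1 u)) ->
  expect (nseq T Probe) (fun g => (is_walking (g v))%:R : K) g1 <= 2^-1 ^+ a.
Proof.
move=> M.
have pos x : 0 <= 2^-1 ^+ x :> K by apply: exprn_ge0; lra.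
have [wk|nwk] := boolP (is_walking (g1 v)); last first.
  apply: expect_le => r; case E: (is_walking _) => //.
  by have := (run_probes T r g1 v).2 E; rewrite (negbTE nwk).
have SE : sending e g1 v = senders e h g v.
  apply/setP=> u; rewrite !inE; congr (_ && _); rewrite /is_sending.
  by case: (M u) => /= [c ->|c /negbTE->|c x y /negbTE->|c i /negbTE->|c /negbTE->].
have [i Di /andP[im S2]] : exists2 i, duty (g1 v) = Walk i &
    (0 < i <= m)%N && (1 < #|senders e h g v|)%N.
  by case: (M v) wk => //= c i _ _ S2 im _ _; exists i; rewrite ?im ?S2.
have kd : (2 * #|senders e h g v| < 3 * 2 ^ m)%N.
  apply: leq_ltn_trans (deg v); rewrite leq_mul2l /=; apply: subset_leq_card.
  by apply/subsetP=> u; rewrite !inE => /andP[].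
have [c cm /andP[kc ck]] := walk_center S2 kd.
have mu1 : 1 <= mu K by rewrite /mu; lra.
have lam0 : 0 <= lam K by rewrite /lam; lra.
have bd := @potential_bound m j n e K T _ c g1 v kc ck cm _ _.
apply: le_trans (_ : expect (nseq T Probe) (potential K c v) g1 <= _).
  apply: le_expect => r; rewrite /potential /is_walking.
  by case: duty => // i'; rewrite exprn_ege1.
apply: le_trans (bd _ _) _.
- by move=> i'; rewrite Di => -[<-].
- by rewrite SE.
rewrite /potential Di.
have H1 : lam K ^+ T <= 2^-1 ^+ (m + a) by apply: lam_half.
have H2 : mu K ^+ dist i c <= 2 ^+ m.
  apply: (@le_trans _ _ (2 ^+ dist i c)).
    by apply: lerXn2r; rewrite ?nnegrE /mu; lra.
  by apply: ler_weXn2l; [lra|rewrite /dist; lia].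
apply: le_trans (_ : 2^-1 ^+ (m + a) * 2 ^+ m <= _).
  by apply: ler_pM => //; rewrite exprn_ge0 // (le_trans _ mu1).
by rewrite exprD mulrAC -exprMn mulVf ?pnatr_eq0 // expr1n mul1r.
Qed.

Lemma relay_fail_prob h g v : quiet g ->
  expect (relay T h) (fun g => (fail (g v))%:R : K) g <=
  (fail (g v))%:R + 2^-1 ^+ a.
Proof.
move=> Q; rewrite /relay /=.
rewrite -[leRHS](@avg_const K rand) ?card_rand_gt0 //; apply: le_avg => w.
rewrite expect_cat; set g1 := gstep _ _ _.
have M u : midway m e h g 0 u (g1 u) by apply: ask_midway.
have f1 : fail (g1 v) = fail (g v).
  by case: (M v).
apply: (@le_trans _ _ (expect (nseq T Probe) (fun g2 : 'I_n -> node => (fail (g v))%:R + (is_walking (g2 v))%:R) g1)).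
  apply: le_expect => r; set g2 := run _ _ _.
  have f2 : fail (g2 v) = fail (g v) by rewrite /g2 (run_probes T r g1 v).1.
  rewrite -[leRHS](@avg_const K rand) ?card_rand_gt0 //=; apply: le_avg => w'.
  rewrite /global_step /lstep /= f2 -/(is_walking (g2 v)).
  by case: fail; case: is_walking; rewrite ?addr0 ?add0r ?ler0n //= lerDl ler0n.
by rewrite expectD expect_const lerD2l; apply: walk_prob M.
Qed.

Definition failures g : K := \sum_v (fail (g v))%:R.

(** Quantifying over all quiet starts, and requiring quiet ends, makes the bounds add up under
    concatenation; this is the union bound over vertices and relays. *)
Definition bounded p (c : K) := forall g, quiet g ->
  (expect p failures g <= failures g + c) /\ (forall r, quiet (run p r g)).

Lemma bounded_nil : bounded [::] 0.
Proof. by move=> g Q; rewrite addr0 /=. Qed.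

Lemma bounded_cat p1 p2 c1 c2 : bounded p1 c1 -> bounded p2 c2 ->
  bounded (p1 ++ p2) (c1 + c2).
Proof.
move=> B1 B2 g Q; have [E1 Q1] := B1 _ Q; split; last first.
  by move=> r; rewrite run_cat; apply: (B2 _ (Q1 r)).2.
rewrite expect_cat.
apply: (@le_trans _ _ (expect p1 (fun g => failures g + c2) g)).
  by apply: le_expect => r; apply: (B2 _ (Q1 r)).1.
by rewrite expectD expect_const addrA lerD2r.
Qed.

Lemma bounded_nseq p c k : bounded p c -> bounded (flatten (nseq k p)) (k%:R * c).
Proof.
move=> B; elim: k => [|k IH]; first by rewrite mul0r; apply: bounded_nil.
by rewrite -natr1 mulrDl mul1r addrC; apply: bounded_cat.
Qed.

Lemma bounded_relay h : bounded (relay T h) (n%:R * 2^-1 ^+ a).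
Proof.
move=> g Q; split; last first.
  by move=> r; apply: (@relayed_quiet T n e h g) => v; apply: run_relay.
rewrite /failures expect_sum.
have -> : n%:R * 2^-1 ^+ a = \sum_(v : 'I_n) 2^-1 ^+ a :> K.
  by rewrite sumr_const card_ord mulr_natl.
by rewrite -big_split; apply: ler_sum => v _; apply: relay_fail_prob.
Qed.

Lemma bounded_relays hs : bounded (relays T hs) ((size hs)%:R * (n%:R * 2^-1 ^+ a)).
Proof.
elim: hs => [|h hs IH]; first by rewrite mul0r; apply: bounded_nil.
rewrite -[relays _ _]/(relay T h ++ relays T hs) /= -natr1 mulrDl mul1r addrC.
exact: bounded_cat (bounded_relay h) IH.
Qed.

Lemma bounded_local st : (forall w g, (quiet g -> quiet (gstep st w g)) /\
   (forall v, fail (gstep st w g v) = fail (g v))) -> bounded [:: st] 0.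
Proof.
move=> H g Q; split; last by move=> r; apply: (H _ _).1.
rewrite addr0 /= -[leRHS](@avg_const K rand) ?card_rand_gt0 //; apply: le_avg => w.
by rewrite /failures; apply: ler_sum => v _; rewrite (H _ _).2.
Qed.

Lemma bounded_phase s :
  bounded (phase T s n) ((s.+1 * (2 * n + 1))%:R * (n%:R * 2^-1 ^+ a)).
Proof.
pose d : K := n%:R * 2^-1 ^+ a.
have -> : (s.+1 * (2 * n + 1))%:R * (n%:R * 2^-1 ^+ a) =
    0 + ((size (sweeps n s))%:R * d + (0 + ((size (sweep n))%:R * d + 0))).
  by rewrite size_sweeps size_sweep !add0r addr0 -mulrDl -natrD -/d mulSn addnC.
rewrite /phase -[Sample :: _]/([:: Sample] ++ _) -[SelfRoot :: _]/([:: SelfRoot] ++ _).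
apply: bounded_cat; last apply: bounded_cat; last apply: bounded_cat;
  last apply: bounded_cat; try exact: bounded_relays.
- apply: bounded_local => w g; split=> [Q|] v; rewrite sampleE; case: ifP => //= _; exact: Q.
- apply: bounded_local => w g; split=> [Q|] v; rewrite selfrootE; case: ifP => //= _; exact: Q.
- by apply: bounded_local => w g; split=> [Q|] v; rewrite commitE.
Qed.

End Failure.

(** * Disappearance of the other roots and success of the protocol *)

Section Success.
Variables (m j a s n : nat) (e : rel 'I_n) (m_gt0 : (0 < m)%N).
Variables (e_sym : symmetric e) (e_conn : connected_graph e).
Variables (src : 'I_n) (msg : nat).
Variable K : realFieldType.
Implicit Types (g : 'I_n -> node).
Local Open Scope ring_scope.

Local Notation gstep := (global_step m j e).
Local Notation run := (execute m j e).
Local Notation rand := {ffun 'I_n -> (chunk m j).-tuple bool}.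
Local Notation expect := (expect m j e).
Local Notation T := (200 * (m + a))%N.
Local Notation good := (good e src msg).
Hypothesis deg : forall v, (2 * #|[set u | e v u]| < 3 * 2 ^ m)%N.

Definition okb g := [forall v, ~~ fail (g v)].

Lemma okP g : reflect (ok g) (okb g).
Proof. exact: forallP. Qed.

Lemma run_ok_before p r g : ok (run p r g) -> ok g.
Proof. by move=> O v; apply: contra (O v); apply: run_fail. Qed.

(** Survival as a root is counted only without failures, since the analysis of a phase assumes that
    none occurred. *)
Definition rooted v g : K := (okb g && (layer (g v) == 0%N))%:R.

Definition decay : K := 2^-1 ^+ j + (1 - 2^-1 ^+ j) ^+ s.

Let half_ge0 : 0 <= 2^-1 ^+ j :> K. Proof. by apply: exprn_ge0; lra. Qed.
Let half_le1 : 2^-1 ^+ j <= 1 :> K. Proof. by apply: exprn_ile1; lra. Qed.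

Lemma decay_ge0 : 0 <= decay.
Proof. by rewrite addr_ge0 // exprn_ge0 // subr_ge0. Qed.

Lemma avg_no_coin (Q : {set 'I_n}) :
  avg (fun w : rand => [forall u in Q, ~~ coin j (w u)]%:R : K) =
  (1 - 2^-1 ^+ j) ^+ #|Q|.
Proof.
pose h (u : 'I_n) (b : (chunk m j).-tuple bool) : K :=
  ((u \in Q) ==> ~~ coin j b)%:R.
rewrite (eq_avg (G := fun w : rand => \prod_u h u (w u))); last first.
  by move=> w; rewrite prod_bool.
rewrite avg_prod -prodr_const [RHS]big_mkcond /=; apply: eq_bigr => u _; rewrite /h.
case: (u \in Q) => /=; last by rewrite avg_const // card_bits_gt0.
rewrite -(@avg_coin K j (chunk m j)) ?leq_addl //.
rewrite -[X in X - _](@avg_const K ((chunk m j).-tuple bool)) ?card_bits_gt0 //.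
by rewrite -avgB; apply: eq_avg => b; case: coin; rewrite ?subrr ?subr0.
Qed.

Lemma avg_coin_at v :
  avg (fun w : rand => (coin j (w v))%:R : K) = 2^-1 ^+ j.
Proof.
have := avg_no_coin [set v]; rewrite cards1 expr1 => H.
rewrite (eq_avg (G := fun w : rand => 1 - [forall u in [set v], ~~ coin j (w u)]%:R)).
  by rewrite avgB avg_const ?card_rand_gt0 // H; ring.
move=> w; case: forallP => [/(_ v)|N].
  by rewrite set11 /= => /negbTE ->; rewrite subrr.
rewrite subr0; case c: coin => //; case: N => u; rewrite inE.
by apply/implyP=> /eqP ->; rewrite c.
Qed.

Lemma phase_root_prob g v : good g -> v != src ->
  expect (phase T s n) (rooted v) g <= decay * rooted v g.
Proof.
move=> G nsrc.
have spec r := @phase_spec m j T s m_gt0 n e e_sym src msg r g G.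
case: (boolP (okb g && (layer (g v) == 0%N))) => [/andP[og /eqP v0]|N]; last first.
  rewrite {2}/rooted (negbTE N) mulr0; apply: expect_le => r; rewrite /rooted.
  case: (boolP (_ && _)) => // /andP[/okP O /eqP l0].
  case: (spec r O) => _ _ /(_ v l0) v0; case/negP: N.
  by rewrite v0 eqxx andbT; apply/okP; apply: run_ok_before O.
rewrite {2}/rooted og v0 eqxx mulr1.
have [Q _ HQ] := @phase_root m j T s m_gt0 n e e_sym e_conn src msg g v G v0 nsrc.
rewrite /phase /=.
(* A and B are the two ways to survive given by [phase_root]: v itself is sampled, or none of the s
   roots in Q is. *)
pose A (w : rand) : K := (coin j (w v))%:R.
pose B (w : rand) : K := [forall u in Q, ~~ coin j (w u)]%:R * (#|Q| == s)%:R.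
apply: (@le_trans _ _ (avg (fun w => A w + B w))).
  apply: le_avg => w; apply: expect_le => r.
  have := HQ (fun v => w v ++ r v).
  rewrite /phase (@run_cons_cat m j n e _ _ (fun v => w v)); last first.
    by move=> u; rewrite size_tuple.
  rewrite /rooted; set g' := execute _ _ _ _ _ _ => H.
  have A0 : 0 <= A w by rewrite ler0n.
  have B0 : 0 <= B w by rewrite mulr_ge0 ?ler0n.
  case: (boolP (okb g' && _)) => [/andP[/okP O /eqP l0]|_]; last by rewrite addr_ge0.
  have tk u : take (chunk m j) (w u ++ r u) = w u.
    by rewrite take_size_cat // size_tuple.
  case: (H O l0) => [|[Qs nc]].
    by rewrite tk /A => ->; rewrite lerDl.
  rewrite /B Qs eqxx mulr1 (_ : [forall u in Q, _]) ?lerDr //.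
  by apply/forall_inP=> u uQ; rewrite -(tk u); apply: nc.
rewrite avgD avg_coin_at /decay lerD2l /B.
case: eqP => [<-|_].
  by under eq_avg => w do rewrite mulr1; rewrite avg_no_coin.
under eq_avg => w do rewrite mulr0.
by rewrite avg_const ?card_rand_gt0 // exprn_ge0 // subr_ge0.
Qed.

Definition prog k := flatten (nseq k (phase T s n)).

Lemma progS k : prog k.+1 = phase T s n ++ prog k. Proof. by []. Qed.

(* A failure is never undone, so [~~ okb g] forces [rooted v] to stay 0. *)
Lemma prog_root_prob k g v : good g \/ ~~ okb g -> v != src ->
  expect (prog k) (rooted v) g <= decay ^+ k * rooted v g.
Proof.
move=> + nsrc; elim: k g => [|k IH] g G; first by rewrite expr0 mul1r.
case: G => [G|N]; last first.
  rewrite {2}/rooted (negbTE N) mulr0; apply: expect_le => r; rewrite /rooted.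
  by case: (boolP (okb _)) => // /okP/run_ok_before/okP; rewrite (negbTE N).
rewrite progS expect_cat.
apply: (@le_trans _ _ (expect (phase T s n) (fun g => decay ^+ k * rooted v g) g)).
  apply: le_expect => r; apply: IH.
  case: (boolP (okb _)) => [/okP O|]; [left|by right].
  by case: (@phase_spec m j T s m_gt0 n e e_sym src msg r g G O).
rewrite expectZ exprSr -mulrA ler_wpM2l ?exprn_ge0 ?decay_ge0 //.
exact: phase_root_prob.
Qed.

Lemma run_prog_spec k r g : good g -> ok (run (prog k) r g) ->
  good (run (prog k) r g) /\
  forall v, (spent (run (prog k) r g v) <= spent (g v) + k * (4 * T + 3 * s + 6))%N.
Proof.
elim: k r g => [|k IH] r g G O; first by split=> // v; rewrite mul0n addn0.
move: O; rewrite progS run_cat => O.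
have [G1 S1 _] := @phase_spec m j T s m_gt0 n e e_sym src msg r g G (run_ok_before O).
have [G2 S2] := IH _ _ G1 O; split=> // v.
apply: leq_trans (S2 v) _; rewrite mulSn.
by apply: leq_trans (leq_add (S1 v) (leqnn _)) _; rewrite -addnA.
Qed.

Definition source_input (v : 'I_n) := if v == src then Some msg else None.

Lemma start_good : good (fun v => start (source_input v)).
Proof. by split=> // v; rewrite /source_input. Qed.

(** Along links the label drops to 0 while the carried input stays the same, and the only root left
    is the source. *)
Lemma good_informed g : good g -> (forall v, v != src -> layer (g v) != 0%N) ->
  forall v, (cur (g v)).2 = Some msg.
Proof.
move=> G H v; move E: (layer (g v)) => l; elim: l v E => [|l IH] v E.
  rewrite (good_root G E) (good_inp G); case: eqP => // /eqP /H.
  by rewrite E.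
have [u _ cu] := good_link G E.
by have := IH u; rewrite /layer cu; apply.
Qed.

Lemma prog_success k
  (P := protocol_of m j (prog k) (k * (4 * T + 3 * s + 6))) :
  (#|[set f | ~~ @run_ok P n e src msg f]|)%:R <=
  (k%:R * ((s.+1 * (2 * n + 1))%:R * (n%:R * 2^-1 ^+ a)) + n%:R * decay ^+ k) *
  (#|{: {ffun 'I_n -> (rbits P).-tuple bool}}|)%:R :> K.
Proof.
set g0 := fun v => start (source_input v).
(* F is at least 1 on every bad run, so its sum bounds the number of bad bit assignments, as in
   Markov's inequality. *)
pose F g : K := failures K g + \sum_(v | v != src) rooted v g.
have F0 g : 0 <= F g.
  by rewrite addr_ge0 // sumr_ge0 // => v _; rewrite /rooted ler0n.
apply: (@le_trans _ _ (\sum_(f : {ffun 'I_n -> (size (prog k) * chunk m j).-tuple bool})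
    F (run (prog k) (fun v => f v) g0))).
  rewrite -sum1_card natr_sum big_mkcond /=; apply: ler_sum => f _.
  case: ifP => // ; rewrite inE => /negP bad.
  set g := run _ _ _.
  rewrite leNgt; apply/negP => F1; apply: bad.
  have roots0 : 0 <= \sum_(v | v != src) rooted v g.
    by rewrite sumr_ge0 // => v _; rewrite /rooted ler0n.
  have fails0 : 0 <= failures K g by rewrite sumr_ge0.
  have O : ok g.
    move=> v; apply/negP => fv; move: F1; apply/negP; rewrite -leNgt.
    apply: (@le_trans _ _ (failures K g)); last by rewrite lerDl.
    by rewrite /failures (bigD1 v) //= fv lerDl sumr_ge0.
  have [G S] := run_prog_spec start_good O.
  have nr v : v != src -> layer (g v) != 0%N.
    move=> vs; apply/negP => /eqP l0; move: F1; apply/negP; rewrite -leNgt.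
    apply: (@le_trans _ _ (\sum_(v | v != src) rooted v g)); last by rewrite lerDr.
    rewrite (bigD1 v) //= {1}/rooted l0 eqxx andbT (introT (okP g) O).
    by rewrite lerDl sumr_ge0 // => u _; rewrite /rooted ler0n.
  apply/forallP => v; rewrite output_run energy_run.
  rewrite -/(source_input) -/g0 -/g.
  by rewrite (good_informed G nr) eqxx /=; apply: S.
rewrite expect_sum_rand ler_wpM2r // /F expectD.
apply: lerD.
  have Q0 : quiet g0 by [].
  have := (@bounded_nseq m j n e K _ _ k (@bounded_phase m j a n e m_gt0 K deg s) g0 Q0).1.
  by rewrite {2}/failures big1 ?add0r.
rewrite expect_sum; apply: (@le_trans _ _ (\sum_(v : 'I_n | v != src) decay ^+ k)).
  apply: ler_sum => v vs; apply: le_trans (prog_root_prob k (or_introl start_good) vs) _.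
  by rewrite ler_piMr ?exprn_ge0 ?decay_ge0 // /rooted; case: (_ && _).
rewrite sumr_const -[leLHS]mulr_natl ler_wpM2r ?exprn_ge0 ?decay_ge0 // ler_nat.
by rewrite -[leqRHS]card_ord max_card.
Qed.

End Success.

(** * Tuned failure probability and the final protocol *)

Section Tuning.
Variable K : realFieldType.
Local Open Scope ring_scope.

(** With [q = 2^-j], [none_bound] gives [(1 - q)^(2^j) <= 1/2]. Raising this to the power [2^j]
    gives [(1 - q)^(4^j) <= 2^-(2^j) <= q], and both summands are at most q. *)
Lemma decay_le j : (0 < j)%N -> decay j (4 ^ j) K <= 2^-1 ^+ j.-1.
Proof.
move=> j0; rewrite /decay.
have h01 : 0 <= 2^-1 :> K by lra.
have h11 : 2^-1 <= 1 :> K by lra.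
pose q : K := 2^-1 ^+ j.
have q0 : 0 <= q by apply: exprn_ge0.
have q1 : q <= 1 by apply: exprn_ile1.
have H : (1 - q) ^+ (2 ^ j) <= 2^-1.
  have := @none_bound K q (2 ^ j); rewrite q0 q1 => /(_ isT).
  rewrite natrX -exprMn mulfV ?pnatr_eq0 // expr1n.
  by set z := _ ^+ _ => ?; lra.
have H2 : (1 - q) ^+ (4 ^ j) <= q.
  rewrite (_ : 4 = 2 * 2)%N // expnMn exprM.
  apply: (@le_trans _ _ (2^-1 ^+ (2 ^ j))).
    by apply: lerXn2r; rewrite ?nnegrE // exprn_ge0 // subr_ge0.
  by apply: ler_wiXn2l => //; apply: ltnW; apply: ltn_expl.
apply: le_trans (_ : q + q <= _); first by rewrite lerD2l.
by rewrite /q -{1 2}(prednK j0) exprS; set z := _ ^+ _; lra.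
Qed.

(** With [h = 2^-L <= 1/n] the left side is at most [h * (12 (n h)^5 + (n h)^2) <= 13 h <= n h <=
    1], which is where [13 <= n] comes from. *)
Lemma failure_le n j L k : (13 <= n)%N -> (n <= 2 ^ L)%N -> (0 < j)%N ->
  (4 ^ j < n)%N -> (k <= 4 * n)%N -> (3 * L <= j.-1 * k)%N ->
  (k%:R * (((4 ^ j).+1 * (2 * n + 1))%:R * (n%:R * 2^-1 ^+ (6 * L))) +
   n%:R * decay j (4 ^ j) K ^+ k) * n%:R <= 1.
Proof.
move=> n13 nL j0 sn kn Lk.
have h01 : 0 <= 2^-1 :> K by lra.
have h11 : 2^-1 <= 1 :> K by lra.
pose h : K := 2^-1 ^+ L; pose N : K := n%:R.
have h0 : 0 <= h by apply: exprn_ge0.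
have N13 : 13 <= N by rewrite /N (ler_nat K 13).
have Nh : N * h <= 1.
  apply: le_trans (_ : 2 ^+ L * h <= _).
    by rewrite ler_wpM2r // -natrX ler_nat.
  by rewrite /h -exprMn mulfV ?pnatr_eq0 // expr1n.
have N0 : 0 <= N by rewrite ler0n.
have T2 : decay j (4 ^ j) K ^+ k <= h ^+ 3.
  apply: le_trans (_ : (2^-1 ^+ j.-1) ^+ k <= _).
    apply: lerXn2r; rewrite ?nnegrE ?decay_ge0 ?decay_le //; exact: exprn_ge0.
  by rewrite /h -!exprM [(L * 3)%N]mulnC; apply: ler_wiXn2l.
have C : ((4 ^ j).+1 * (2 * n + 1))%:R <= 3 * N ^+ 2.
  rewrite /N -natrX -natrM ler_nat.
  apply: (@leq_trans (n * (3 * n))); last by rewrite mulnCA.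
  by apply: leq_mul => //; lia.
have kN : k%:R <= 4 * N by rewrite /N -natrM ler_nat.
have T1 : k%:R * (((4 ^ j).+1 * (2 * n + 1))%:R * (n%:R * 2^-1 ^+ (6 * L)))
    <= 12 * N ^+ 4 * h ^+ 6.
  rewrite -/N [(6 * L)%N]mulnC exprM -/h.
  have -> : 12 * N ^+ 4 * h ^+ 6 = (4 * N) * ((3 * N ^+ 2) * (N * h ^+ 6)) by ring.
  have Nh0 : 0 <= N * h ^+ 6 by rewrite mulr_ge0 // exprn_ge0.
  apply: ler_pM => //; first by rewrite mulr_ge0.
  by rewrite ler_wpM2r.
rewrite -/N; apply: le_trans (_ : (12 * N ^+ 4 * h ^+ 6 + N * h ^+ 3) * N <= _).
  by rewrite ler_wpM2r // lerD // ler_wpM2l.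
have -> : (12 * N ^+ 4 * h ^+ 6 + N * h ^+ 3) * N =
  h * (12 * (N * h) ^+ 5 + (N * h) ^+ 2) by ring.
have P0 : 0 <= N * h by rewrite mulr_ge0.
have P5 : (N * h) ^+ 5 <= 1 by rewrite exprn_ile1.
have P2 : (N * h) ^+ 2 <= 1 by rewrite exprn_ile1.
apply: le_trans (_ : h * 13 <= _); first by rewrite ler_wpM2l //; lra.
by apply: le_trans Nh; rewrite mulrC ler_wpM2r.
Qed.

End Tuning.

Lemma size_relay T h : size (relay T h) = (T + 2)%N.
Proof. by rewrite /relay /= size_cat size_nseq addn1 addn2. Qed.

Lemma size_relays T hs : size (relays T hs) = (size hs * (T + 2))%N.
Proof.
elim: hs => [|h hs IH] //.
by rewrite -[relays _ _]/(relay T h ++ relays T hs) size_cat IH size_relay mulSn.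
Qed.

Lemma size_prog m a s n k : size (prog m a s n k) =
  (k * ((s.+1 * (2 * n + 1)) * (200 * (m + a) + 2) + 3))%N.
Proof.
have -> : ((s.+1 * (2 * n + 1)) * (200 * (m + a) + 2) + 3)%N =
    size (phase (200 * (m + a)) s n).
  rewrite /phase /= size_cat /= size_cat /= !size_relays size_sweeps size_sweep.
  by rewrite mulSn mulnDl; lia.
by elim: k => [|k IH] //; rewrite progS size_cat IH mulSn.
Qed.

(** With degrees at most 1, a vertex and its neighbour form a closed set of at most two vertices.
    The bound keeps [ln D] away from 0 in the time bound. *)
Lemma max_degree_ge2 n (e : rel 'I_n) : (2 < n)%N -> simple_graph e ->
  connected_graph e -> (2 <= max_degree e)%N.
Proof.
move=> n3 [e_sym _] e_conn; rewrite leqNgt; apply/negP => d1.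
have deg v : (#|[set u | e v u]| <= 1)%N.
  by apply: leq_trans (_ : max_degree e <= 1)%N => //; apply: leq_bigmax.
have n0 : (0 < n)%N by lia.
pose v0 := Ordinal n0; pose S := v0 |: [set u | e v0 u].
have cl : closed e S.
  apply: intro_closed => [|x y exy]; first exact: sym_connect_sym.
  rewrite !inE.
  have two x' y' z : e x' y' -> e x' z -> y' = z.
    move=> e1 e2; have /card_le1P/(_ y') := deg x'; rewrite inE => /(_ e1 z).
    by rewrite !inE e2 => /esym/eqP.
  case/orP=> [/eqP xE|e0]; first by rewrite -xE exy orbT.
  by rewrite (two x y v0 exy _) ?eqxx // e_sym.
have full u : u \in S.
  by rewrite -(closed_connect cl (e_conn v0 u)) !inE eqxx.
have : (#|S| <= 2)%N.
  by rewrite cardsU1; have := deg v0; case: (_ \notin _) => /=; lia.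
have -> : S = setT by apply/setP=> u; rewrite full inE.
by rewrite cardsT card_ord; lia.
Qed.

Lemma degree_le_card n (e : rel 'I_n) : (max_degree e <= n)%N.
Proof.
apply/bigmax_leqP => v _; rewrite -[X in (_ <= X)%N]card_ord; exact: max_card.
Qed.

(** [a = 6 * ladder n] makes a listener fail in a relay with probability at most [n^-6], small
    enough for a union bound over all vertices and relays. *)
Definition broadcast (j n D : nat) : protocol :=
  let m := ladder D in let a := (6 * ladder n)%N in let k := rounds n j in
  protocol_of m j (prog m a (4 ^ j) n k)
    (k * (4 * (200 * (m + a)) + 3 * 4 ^ j + 6)).

Lemma slots_broadcast j n D : slots (broadcast j n D) =
  (rounds n j * (((4 ^ j).+1 * (2 * n + 1)) *
    (200 * (ladder D + 6 * ladder n) + 2) + 3) * (ladder D).+1)%N.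
Proof.
rewrite -[slots _]/(size (prog (ladder D) (6 * ladder n) (4 ^ j) n (rounds n j)) * _)%N.
by rewrite size_prog.
Qed.

Lemma broadcast_whp j n (e : rel 'I_n) s msg : symmetric e ->
  connected_graph e -> (13 <= n)%N -> (2 <= j)%N -> (4 ^ j < n)%N ->
  whp_success 1 (broadcast j n (max_degree e)) e s msg.
Proof.
move=> e_sym e_conn n13 j2 sn.
have deg v : (2 * #|[set u | e v u]| < 3 * 2 ^ ladder (max_degree e))%N.
  have dv : (#|[set u | e v u]| <= max_degree e)%N by apply: leq_bigmax.
  have := trunc_log_ltn (max_degree e) (isT : 1 < 2)%N; rewrite -/(ladder _); lia.
have nL : (n <= 2 ^ ladder n)%N by apply/ltnW/trunc_log_ltn.
have Ln : (ladder n <= n)%N.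
  apply: leq_trans (ltn_expl _ (isT : 1 < 2)%N) _.
  by apply: trunc_logP => //; lia.
have kn : (rounds n j <= 4 * n)%N.
  have := leq_div (3 * ladder n) j.-1; rewrite /rounds; lia.
have Lk : (3 * ladder n <= j.-1 * rounds n j)%N.
  rewrite [(j.-1 * _)%N]mulnC; apply: ltnW; apply: ltn_ceil; by rewrite -ltnS prednK ?(ltnW j2).
have F := @failure_le rat n j (ladder n) (rounds n j) n13 nL (ltnW j2) sn kn Lk.
have S := @prog_success (ladder (max_degree e)) j (6 * ladder n) (4 ^ j) n e isT
  e_sym e_conn s msg rat deg (rounds n j).
rewrite /whp_success expn1 -(ler_nat rat) natrM.
apply: le_trans (ler_wpM2r _ S) _; first by rewrite ler0n.
by rewrite mulrAC ler_piMl.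
Qed.

Theorem theorem5 :
  exists (C : R) (c : nat), Rlt 0 C /\ (1 <= c)%N /\
  forall eps : R, Rlt 0 eps -> Rlt eps 1 ->
  exists (n0 : nat) (alg : nat -> nat -> protocol),
  forall (n D : nat), (n0 <= n)%N ->
  forall e : rel 'I_n,
    simple_graph e -> connected_graph e -> max_degree e = D ->
    Rle (INR (slots (alg n D))) (Rmult C (time_bound eps n D)) /\
    Rle (INR (budget (alg n D))) (Rmult C (energy_bound eps n)) /\
    (forall (s : 'I_n) (m : nat), whp_success c (alg n D) e s m).
Proof.
exists (IZR 12000000), 1; split; first exact: IZR_lt.
split=> // eps e0 e1; have [n0 [jf tune]] := exists_tuned e0 e1.
exists n0, (fun n D => broadcast (jf n) n D) => n D nn0 e G conn <-.
have P := tune n nn0; have n13 := tuned_n P.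
have D2 : (2 <= max_degree e)%N by apply: max_degree_ge2 => //; apply: leq_trans n13.
have Dn := degree_le_card e.
split; last split.
- by rewrite slots_broadcast; apply: slots_le e0 e1 P D2 Dn.
- exact: budget_le e0 e1 P Dn.
- move=> s msg; apply: broadcast_whp => //; [exact: G.1|exact: tuned_j P|].
  exact: tuned_s P.
Qed.
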